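(* Let $(G,c)$ be an infinite network and let $\Lambda$, $S$, $S'$ be given by construction (A) or (B) of the context. Then $S\subset\mathcal H_{\mathcal E}\subset S'$ is a Gel'fand triple, and the energy form $\langle\cdot,\cdot\rangle_{\mathcal E}$ extends to a pairing on $S\times S'$ (the evaluation pairing $\langle u,v\rangle_{\mathcal W}=v(u)$), given by $$\langle u,v\rangle_{\mathcal W}:=\langle\Lambda^pu,\Lambda^{-p}v\rangle_{\mathcal E},\qquad u\in S,\ v\in S',$$ where $p$ is any nonnegative integer such that, for some $K>0$, $|v(u)|\le K\|\Lambda^pu\|_{\mathcal E}$ for all $u\in S$.
   Context: Network: a vertex set $G$ with conductances $c_{xy}=c_{yx}\in[0,\infty)$, $c_{xx}=0$; $x\sim y$ iff $c_{xy}>0$; the resulting graph is connected, and $c(x):=\sum_{y\sim x}c_{xy}<\infty$ for every $x$. Fix a vertex $o$. All functions are real-valued. Laplacian: $(\Delta v)(x)=\sum_{y\sim x}c_{xy}(v(x)-v(y))$. Energy: $\mathcal E(u,v)=\frac12\sum_{x,y}c_{xy}(u(x)-u(y))(v(x)-v(y))$. $\mathcal H_{\mathcal E}$ is the Hilbert space of functions on $G$ with $\mathcal E(u,u)<\infty$ modulo constants, with inner product $\langle u,v\rangle_{\mathcal E}=\mathcal E(u,v)$. The energy kernel $v_x\in\mathcal H_{\mathcal E}$ is the unique element with $\langle v_x,u\rangle_{\mathcal E}=u(x)-u(o)$ for all $u$. $\delta_x\in\mathcal H_{\mathcal E}$ is the class of the characteristic function of $\{x\}$. Construction (A): enumerate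 $G\setminus\{o\}=\{x_1,x_2,\dots\}$, let $\{\varepsilon_n\}$ be the orthonormal basis obtained by Gram-Schmidt from $v_{x_1},v_{x_2},\dots$; let $\Lambda$ be the self-adjoint operator with $\Lambda\varepsilon_n=n\varepsilon_n$ (closure from $\operatorname{span}\{\varepsilon_n\}$). Construction (B) (for networks on which $\Delta$ is unbounded on $\mathcal H_{\mathcal E}$, i.e. $\Delta_M$ below is unbounded): let $\mathrm{Fin}$ be the closure of $\operatorname{span}\{\delta_x\}$ in $\mathcal H_{\mathcal E}$, $f_x$ the orthogonal projection of $v_x$ on $\mathrm{Fin}$; a monopole at $x$ is $w\in\mathcal H_{\mathcal E}$ with $\Delta w=\delta_x$ pointwise; if monopoles exist let $w_o$ be the monopole at $o$ of minimal energy. Let $\mathcal M=\operatorname{span}\{v_x\}_{x}+\operatorname{span}\{v_x+w_o,\,f_x+w_o\}_x$ (the second summand being omitted if there are no monopoles). $\Delta_M$ is the closure in $\mathcal H_{\mathcal E}$ of $\Delta$ with domain $\mathcal M$, and $\Lambda$ is a self-adjoint extension of $\Delta_M$. In both cases $S=\bigcap_{p\ge1}\operatorname{dom}(\Lambda^p)$ with the Fréchet topology given by the seminorms $u\mapsto\|\Lambda^pu\|_{\mathcal E}$, $p=0,1,2,\dots$, and $S'$ is the space of real continuous linear functionals on $S$. Gel'fand triple: $S$ is a dense subspace of $\mathcal H_{\mathcal E}$ carrying a Fréchet topology strictly finer than the norm topology, the inclusion $S\hookrightarrow\mathcal H_{\mathcal E}$ is continuous, $S'$ is the dual of $S$ for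 this topology, and $\mathcal H_{\mathcal E}\subset S'$ via $v\mapsto\langle\cdot,v\rangle_{\mathcal E}$, the containments being strict. Meaning of $\Lambda^{-p}v$ for $v\in S'$ with $|v(u)|\le K\|\Lambda^pu\|_{\mathcal E}$ on $S$: the map $\Lambda^ps\mapsto v(s)$ is a well-defined bounded linear functional on $\Lambda^pS$; extend it continuously to the closure of $\Lambda^pS$ and by $0$ to the orthogonal complement; $\Lambda^{-p}v\in\mathcal H_{\mathcal E}$ is its Riesz representative.
   Formalization: The formula for the pairing is asserted for every v in S' and every p satisfying the bound; that each v admits such a p is not asserted, since under (B) it can fail (when Λ has a harmonic function in its kernel); under (A) it always holds because Λ ≥ 1. *)

(* Defs.v *)
From HB Require Import structures.
From mathcomp Require Import all_boot all_order all_algebra.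
From mathcomp Require Import generic_quotient ring_quotient ring lra.
From mathcomp Require Import all_classical all_reals all_analysis.

Set Implicit Arguments.
Unset Strict Implicit.
Unset Printing Implicit Defensive.

Import Order.TTheory GRing.Theory Num.Theory.
Import numFieldNormedType.Exports.

Local Open Scope classical_set_scope.
Local Open Scope ring_scope.

Section AbsoluteSums.
Context {R : realType} {T : choiceType}.
Implicit Types f g : T -> R.

Definition abs_summable f := summable [set: T] (EFin \o f).

(* Unconditional sum of a real family; meaningful for abs_summable families,
   which is the only case in which it is used. *)
Definition rsum f : R :=
  fine (\esum_(i in [set: T]) (EFin \o f)^\+%E i) -
  fine (\esum_(i in [set: T]) (EFin \o f)^\-%E i).

Lemma abs_summableE f :
  abs_summable f <-> (\esum_(i in [set: T]) `|f i|%:E < +oo)%E.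
Proof. by []. Qed.

Lemma le_abs_summable f g :
  (forall i, `|f i| <= g i) -> abs_summable g -> abs_summable f.
Proof.
move=> fg; apply: le_lt_trans; apply: le_esum => i _ /=.
by rewrite lee_fin (le_trans (fg i)) ?ler_norm.
Qed.

Lemma abs_summableD f g :
  abs_summable f -> abs_summable g -> abs_summable (fun i => f i + g i).
Proof. by move=> sf sg; have := summableD sf sg. Qed.

Lemma esumZl (a : R) f : 0 <= a -> (forall i, 0 <= f i) ->
  (\esum_(i in [set: T]) (a * f i)%:E =
   a%:E * \esum_(i in [set: T]) (f i)%:E)%E.
Proof.
move=> a0 f0; rewrite /esum -ereal_supZl//; last first.
  by apply/set0P; exists (\sum_(x \in set0) (f x)%:E)%E, set0 => //; split.
congr ereal_sup; apply/seteqP; split=> [_ [A finA <-]|_ [_ [A finA <-] <-]].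
  exists (\sum_(x \in A) (f x)%:E)%E; first by exists A.
  rewrite !fsbig_finite /=; [|exact: finA.1|exact: finA.1].
  by rewrite ge0_sume_distrr// => i _; rewrite lee_fin.
exists A => //; rewrite !fsbig_finite /=; [|exact: finA.1|exact: finA.1].
by rewrite ge0_sume_distrr// => i _; rewrite lee_fin.
Qed.

Lemma abs_summableZ (a : R) f :
  abs_summable f -> abs_summable (fun i => a * f i).
Proof.
move=> sf; rewrite /abs_summable /summable /=.
under eq_esum do rewrite normrM.
by rewrite esumZl// lte_mul_pinfty// lee_fin.
Qed.

Lemma rsumE f : rsum f =
  fine (\esum_(i in [set: T]) (Num.max (f i) 0)%:E) -
  fine (\esum_(i in [set: T]) (Num.max (- f i) 0)%:E).
Proof.
rewrite /rsum; congr (fine _ - fine _); apply: eq_esum => i _ /=.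
  by rewrite funeposE /= -EFin_max.
by rewrite funenegE /= -EFin_max.
Qed.

Let esum_fin f : abs_summable f -> (forall i, 0 <= f i) ->
  (\esum_(i in [set: T]) (f i)%:E)%E \is a fin_num.
Proof.
move=> sh h0; rewrite ge0_fin_numE; last by apply: esum_ge0 => i; rewrite lee_fin.
by apply: le_lt_trans sh; apply: le_esum => i _ /=; rewrite lee_fin ler_norm.
Qed.

Lemma rsumB f g : abs_summable f -> abs_summable g ->
  (forall i, 0 <= f i) -> (forall i, 0 <= g i) ->
  rsum (fun i => f i - g i) =
  fine (\esum_(i in [set: T]) (f i)%:E) - fine (\esum_(i in [set: T]) (g i)%:E).
Proof.
move=> sf sg f0 g0.
pose h i := f i - g i; have sfg : abs_summable h.
  have := abs_summableD sf (abs_summableZ (-1) sg).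
  by apply: eq_ind; congr abs_summable; apply/funext => i; rewrite mulN1r.
have finp : (\esum_(i in [set: T]) (EFin \o h)^\+ i)%E \is a fin_num.
  rewrite ge0_fin_numE; last exact: esum_ge0.
  have := summable_funepos sfg; rewrite /summable.
  by under eq_esum => i _ do rewrite gee0_abs//.
have finn : (\esum_(i in [set: T]) (EFin \o h)^\- i)%E \is a fin_num.
  rewrite ge0_fin_numE; last exact: esum_ge0.
  have := summable_funeneg sfg; rewrite /summable.
  by under eq_esum => i _ do rewrite gee0_abs//.
rewrite /rsum -!fineB ?esum_fin//; congr fine.
by apply: (esumB sf sg) => i _; rewrite lee_fin.
Qed.

Let pos f i := Num.max (f i) 0.
Let neg f i := Num.max (- f i) 0.

Let pos_ge0 f i : 0 <= pos f i. Proof. by rewrite le_max lexx orbT. Qed.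
Let neg_ge0 f i : 0 <= neg f i. Proof. by rewrite le_max lexx orbT. Qed.
Let posnegE f i : f i = pos f i - neg f i.
Proof.
rewrite /pos /neg; case: (leP (f i) 0) => fi.
  by rewrite (max_idPl _) ?oppr_ge0// sub0r opprK.
by rewrite (max_idPr _) ?oppr_le0 ?subr0// ltW.
Qed.
Let summable_pos f : abs_summable f -> abs_summable (pos f).
Proof.
apply: le_lt_trans; apply: le_esum => i _ /=; rewrite lee_fin ger0_norm//.
by rewrite /pos ge_max ler_norm normr_ge0.
Qed.
Let summable_neg f : abs_summable f -> abs_summable (neg f).
Proof.
apply: le_lt_trans; apply: le_esum => i _ /=; rewrite lee_fin ger0_norm//.
by rewrite /neg ge_max -normrN ler_norm normr_ge0.
Qed.
Lemma rsumD f g : abs_summable f -> abs_summable g ->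
  rsum (fun i => f i + g i) = rsum f + rsum g.
Proof.
move=> sf sg.
have -> : (fun i => f i + g i) =
    (fun i => (pos f i + pos g i) - (neg f i + neg g i)).
  by apply/funext => i; rewrite {1}(posnegE f) {1}(posnegE g) opprD addrACA.
have eD h k : abs_summable h -> abs_summable k ->
    (forall i, 0 <= h i) -> (forall i, 0 <= k i) ->
  fine (\esum_(i in [set: T]) (h i + k i)%:E) =
  fine (\esum_(i in [set: T]) (h i)%:E) + fine (\esum_(i in [set: T]) (k i)%:E).
  move=> sh sk h0 k0; rewrite -fineD ?esum_fin// -esumD// => i _; by rewrite lee_fin.
rewrite rsumB; [|exact/abs_summableD/summable_pos/sg/summable_pos
  |exact/abs_summableD/summable_neg/sg/summable_neg
  |by move=> i; rewrite addr_ge0|by move=> i; rewrite addr_ge0].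
rewrite !rsumE !eD//; [|exact: summable_neg|exact: summable_neg
  |exact: summable_pos|exact: summable_pos].
by rewrite opprD addrACA.
Qed.

Lemma rsumZ (a : R) f : abs_summable f -> rsum (fun i => a * f i) = a * rsum f.
Proof.
move=> sf; have [a0|a0] := leP 0 a.
  have -> : (fun i => a * f i) = (fun i => a * pos f i - a * neg f i).
    by apply/funext => i; rewrite {1}(posnegE f) mulrBr.
  rewrite rsumB; [|exact/abs_summableZ/summable_pos
    |exact/abs_summableZ/summable_neg
    |by move=> i; rewrite mulr_ge0|by move=> i; rewrite mulr_ge0].
  rewrite !esumZl// !fineM ?esum_fin//; [|exact: summable_neg|exact: summable_pos].
  by rewrite rsumE mulrBr.
have -> : (fun i => a * f i) = (fun i => - a * neg f i - (- a) * pos f i).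
  by apply/funext => i; rewrite {1}(posnegE f) mulrBr !mulNr opprK addrC.
have a0' : 0 <= - a by rewrite oppr_ge0 ltW.
rewrite rsumB; [|exact/abs_summableZ/summable_neg
  |exact/abs_summableZ/summable_pos
  |by move=> i; rewrite mulr_ge0|by move=> i; rewrite mulr_ge0].
rewrite !esumZl// !fineM ?esum_fin//; [|exact: summable_pos|exact: summable_neg].
by rewrite rsumE mulrBr /= !mulNr opprK addrC.
Qed.

Lemma rsum_ge0E f : (forall i, 0 <= f i) ->
  rsum f = fine (\esum_(i in [set: T]) (f i)%:E).
Proof.
move=> f0; rewrite rsumE [X in _ - fine X]esum1 ?subr0.
  by congr fine; apply: eq_esum => i _; rewrite (max_idPl _).
by move=> i _; rewrite (max_idPr _)// oppr_le0.
Qed.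

Lemma rsum_ge0 f : (forall i, 0 <= f i) -> 0 <= rsum f.
Proof.
by move=> f0; rewrite rsum_ge0E//; apply/fine_ge0/esum_ge0 => i _; rewrite lee_fin.
Qed.

Lemma rsum_eq0 f : abs_summable f -> (forall i, 0 <= f i) ->
  rsum f = 0 -> forall i, f i = 0.
Proof.
move=> sf f0; rewrite rsum_ge0E// => /eqP; rewrite fine_eq0 ?esum_fin// => /eqP e i.
apply/eqP; rewrite eq_le f0 andbT; suff : ((f i)%:E <= 0)%E by [].
rewrite -e; apply: esum_ge; exists [set i]; first by split.
by rewrite fsbig_set1.
Qed.

End AbsoluteSums.

(* Sums over the neighbours of x are written as sums over all vertices: the
   other terms vanish. *)
Record network (R : realType) (G : choiceType) := Network {
  cond :> G -> G -> R;
  cond_ge0 : forall x y, 0 <= cond x y;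
  condC : forall x y, cond x y = cond y x;
  condxx : forall x, cond x x = 0;
  cond_connected : forall x y,
    exists2 p, path (fun a b => 0 < cond a b) x p & last x p = y;
  cond_finite : forall x, (\esum_(y in [set: G]) (cond x y)%:E < +oo)%E
}.

Section Energy.
Context {R : realType} {G : choiceType} (N : network R G).
Implicit Types u v : G -> R.

Definition laplacian u : G -> R := fun x => rsum (fun y => N x y * (u x - u y)).

Definition energy_term u v (xy : G * G) : R :=
  N xy.1 xy.2 * (u xy.1 - u xy.2) * (v xy.1 - v xy.2).

Definition energy u v : R := 2^-1 * rsum (energy_term u v).

Definition finite_energy u : Prop :=
  (\esum_(xy in [set: G * G]) (energy_term u u xy)%:E < +oo)%E.

Lemma energy_term_ge0 u xy : 0 <= energy_term u u xy.
Proof. by rewrite /energy_term -mulrA mulr_ge0 ?cond_ge0// -expr2 sqr_ge0. Qed.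

Lemma finite_energyE u : finite_energy u <-> abs_summable (energy_term u u).
Proof.
rewrite /finite_energy /abs_summable /summable.
by under [in X in _ <-> X]eq_esum => xy _ do rewrite /= ger0_norm ?energy_term_ge0//.
Qed.

Lemma energy_term_summable u v : finite_energy u -> finite_energy v ->
  abs_summable (energy_term u v).
Proof.
move=> /finite_energyE su /finite_energyE sv.
apply: (le_abs_summable _ (abs_summableD su sv)) => -[x y] /=.
rewrite /energy_term /= -!mulrA -mulrDr normrM ger0_norm ?cond_ge0//.
rewrite ler_wpM2l ?cond_ge0//; set a := u x - u y; set b := v x - v y.
rewrite ler_norml; apply/andP; split.
  rewrite -subr_ge0 opprK.
  have -> : a * b + (a * a + b * b) = ((a + b) ^+ 2 + a ^+ 2 + b ^+ 2) / 2 by field.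
  by rewrite divr_ge0// !addr_ge0// sqr_ge0.
rewrite -subr_ge0.
have -> : a * a + b * b - a * b = ((a - b) ^+ 2 + a ^+ 2 + b ^+ 2) / 2 by field.
by rewrite divr_ge0// !addr_ge0// sqr_ge0.
Qed.

Lemma energyC u v : energy u v = energy v u.
Proof.
congr (_ * rsum _); apply/funext => xy.
by rewrite /energy_term -!mulrA [(u _ - _) * _]mulrC.
Qed.

Lemma finite_energyD u v :
  finite_energy u -> finite_energy v -> finite_energy (u + v).
Proof.
move=> su sv; apply/finite_energyE.
have -> : energy_term (u + v) (u + v) = (fun xy =>
    (energy_term u u xy + energy_term u v xy) +
    (energy_term u v xy + energy_term v v xy)).
  by apply/funext => xy; rewrite /energy_term !fctE; ring.
by do 2!apply: abs_summableD; exact: energy_term_summable.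
Qed.

Lemma finite_energyZ (a : R) u : finite_energy u -> finite_energy (a *: u).
Proof.
move=> su; apply/finite_energyE.
have -> : energy_term (a *: u) (a *: u) = (fun xy => a ^+ 2 * energy_term u u xy).
  by apply/funext => xy; rewrite /energy_term !fctE /GRing.scale /=; ring.
exact/abs_summableZ/finite_energyE.
Qed.

Lemma energyDl u v w : finite_energy u -> finite_energy v -> finite_energy w ->
  energy (u + v) w = energy u w + energy v w.
Proof.
move=> su sv sw; rewrite /energy -mulrDr -rsumD; do ?exact: energy_term_summable.
congr (_ * rsum _); apply/funext => xy; rewrite /energy_term !fctE; ring.
Qed.

Lemma energyZl (a : R) u v : finite_energy u -> finite_energy v ->
  energy (a *: u) v = a * energy u v.
Proof.
move=> su sv; rewrite /energy mulrCA -[a * _]rsumZ; last exact: energy_term_summable.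
congr (_ * rsum _); apply/funext => xy.
rewrite /energy_term !fctE /GRing.scale /=; ring.
Qed.

Lemma energy_ge0 u : 0 <= energy u u.
Proof. by rewrite mulr_ge0 ?invr_ge0// rsum_ge0// => xy; exact: energy_term_ge0. Qed.

Lemma finite_energy_cst (a : R) : finite_energy (cst a).
Proof.
rewrite /finite_energy esum1// => xy _.
by rewrite /energy_term /= subrr mulr0.
Qed.

Lemma energy_cst (a : R) u : energy (cst a) u = 0.
Proof.
rewrite /energy (_ : energy_term _ _ = cst 0).
  by rewrite rsum_ge0E// esum1// mulr0.
by apply/funext => xy; rewrite /energy_term /= subrr mulr0 mul0r.
Qed.

Lemma energy_eq0 u : finite_energy u -> energy u u = 0 -> exists a, u = cst a.
Proof.
move=> su /eqP; rewrite mulf_eq0 invr_eq0 pnatr_eq0 /= => /eqP u0.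
have {}u0 := rsum_eq0 ((finite_energyE u).1 su) (energy_term_ge0 u) u0.
have uE x y : 0 < N x y -> u x = u y.
  move=> Nxy; apply/eqP; rewrite -subr_eq0; have /eqP := u0 (x, y).
  by rewrite /energy_term /= !mulf_eq0 -orbA orbb gt_eqF.
have [[x]|G0] := pselect (inhabited G); last first.
  by exists 0; apply/funext => x; case: G0.
exists (u x); apply/funext => y; have [p + <-] := cond_connected N x y.
by elim: p x => //= z p IH x /andP[/uE -> /IH].
Qed.

Definition indic1 (x : G) : G -> R := fun y => (y == x)%:R.

Lemma finite_energy_indic1 x : finite_energy (indic1 x).
Proof.
pose row (ab : G * G) := if ab.1 == x then N ab.1 ab.2 else 0.
have row0 ab : 0 <= row ab by rewrite /row; case: ifP => // _; exact: cond_ge0.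
have row_le a b : row (a, b) <= N a b.
  by rewrite /row /=; case: ifP => // _; exact: cond_ge0.
have rowoo : (\esum_(ab in [set: G * G]) (row ab)%:E < +oo)%E.
  have -> : [set: G * G] = [set: G] `*`` (fun=> [set: G]).
    by apply/seteqP; split.
  rewrite -(@esum_esum _ _ _ _ _ (fun a b => (row (a, b))%:E)); last first.
    by move=> a b _ _; rewrite lee_fin.
  have := cond_finite N x; rewrite -(@esum_set1 R G x (fun a =>
    \esum_(b in [set: G]) (N a b)%:E)%E); last first.
    by apply: esum_ge0 => b _; rewrite lee_fin cond_ge0.
  apply: le_lt_trans; rewrite [leRHS]esum_mkcond; apply: le_esum => a _.
  case: ifPn => [_|]; first by apply: le_esum => b _; rewrite lee_fin; apply: row_le.
  rewrite notin_setE /= => /eqP ax; rewrite esum1// => b _.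
  by rewrite /row /= (negbTE ax).
have coloo : (\esum_(ab in [set: G * G]) (row (ab.2, ab.1))%:E < +oo)%E.
  rewrite -(reindex_esum setT setT (fun ab : G * G => (ab.2, ab.1))
    (fun ab => (row ab)%:E))//.
  split=> //; first by move=> [a b] [a' b'] _ _ [-> ->].
  by move=> [a b] _; exists (b, a).
apply: le_lt_trans (lte_add_pinfty rowoo coloo).
rewrite -esumD; do ?by move=> *; rewrite lee_fin.
apply: le_esum => -[a b] _; rewrite -EFinD lee_fin /energy_term /row /indic1 /=.
rewrite -mulrA; case: eqVneq => [->|ax]; case: eqVneq => [->|bx].
- by rewrite subrr !mulr0 addr_ge0// cond_ge0.
- by rewrite subr0 !mulr1 addr0.
- by rewrite sub0r mulrNN !mulr1 add0r condC.
- by rewrite subrr !mulr0 addr0.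
Qed.

End Energy.

HB.mixin Record isInnerProduct (R : realType) V & NormedModule R V := {
  dot : V -> V -> R;
  dotC : forall u v, dot u v = dot v u;
  dotDl : forall u v w, dot (u + v) w = dot u w + dot v w;
  dotZl : forall (a : R) u v, dot (a *: u) v = a * dot u v;
  normr_dot : forall u : V, `|u| = Num.sqrt (dot u u)
}.

#[short(type="innerProductType")]
HB.structure Definition InnerProduct (R : realType) :=
  {V of NormedModule R V & isInnerProduct R V}.

Section FiniteEnergyFunctions.
Context {R : realType} {G : choiceType} (N : network R G).

Definition finE_pred : {pred G -> R} := fun u => `[< finite_energy N u >].

Fact finE_submod : submod_closed finE_pred.
Proof.
split; first exact/asboolP/(finite_energy_cst N 0).
move=> a u v /asboolP su /asboolP sv.
by apply/asboolP/finite_energyD => //; exact: finite_energyZ.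
Qed.
HB.instance Definition _ := GRing.isSubmodClosed.Build R (G -> R) finE_pred finE_submod.

Record finE := FinE { finE_fun :> G -> R; finEP : finE_fun \in finE_pred }.
HB.instance Definition _ := [isSub for finE_fun].
HB.instance Definition _ := [Choice of finE by <:].
HB.instance Definition _ := [SubChoice_isSubLmodule of finE by <:].

Definition const_pred : {pred finE} := fun u => `[< exists a : R, u = cst a :> (G -> R) >].

Fact const_submod : submod_closed const_pred.
Proof.
split; first by apply/asboolP; exists 0.
move=> a u v /asboolP[b ub] /asboolP[c vc]; apply/asboolP; exists (a * b + c).
by apply/funext => x; rewrite /= !fctE ub vc.
Qed.
HB.instance Definition _ := GRing.isSubmodClosed.Build R finE const_pred const_submod.

End FiniteEnergyFunctions.

Section EnergySpace.
Local Open Scope quotient_scope.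
Context {R : realType} {G : choiceType} (N : network R G).

Definition HE : Type := Quotient.quot (@const_pred R G N).
HB.instance Definition _ := Choice.on HE.
HB.instance Definition _ := GRing.Zmodule.on HE.
HB.instance Definition _ := EqQuotient.on HE.

Implicit Types (u v : finE N) (U V W : HE).

Definition class_of u : HE := \pi_HE u.

Definition rep U : finE N := repr U.

Lemma repK U : class_of (rep U) = U.
Proof. exact: reprK. Qed.

Lemma class_ofP u v :
  class_of u = class_of v <-> exists a : R, u - v = cst a :> (G -> R).
Proof.
split=> [/eqP|e].
  by rewrite /class_of -Quotient.idealrBE => /asboolP.
by apply/eqP; rewrite /class_of -Quotient.idealrBE; apply/asboolP.
Qed.

Lemma class_of0 : class_of 0 = 0.
Proof. exact: (raddf0 \pi_HE). Qed.
Lemma class_ofB u v : class_of (u - v) = class_of u - class_of v.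
Proof. exact: (raddfB \pi_HE). Qed.
Lemma class_ofD u v : class_of (u + v) = class_of u + class_of v.
Proof. exact: (raddfD \pi_HE). Qed.

Lemma rep_class u : exists a : R, forall x, rep (class_of u) x = u x + a.
Proof.
have /class_ofP[a e] : class_of (rep (class_of u)) = class_of u by rewrite repK.
exists a => x; have /(congr1 (@^~ x)) := e; rewrite /= => <-.
by rewrite addrC subrK.
Qed.

Definition HEscale (a : R) U : HE := class_of (a *: rep U).

Lemma HEscale_class a u : HEscale a (class_of u) = class_of (a *: u).
Proof.
apply/class_ofP; have [b ub] := rep_class u; exists (a * b).
apply/funext => x /=; rewrite !fctE ub /GRing.scale /=; ring.
Qed.

Fact HEscaleA a b U : HEscale a (HEscale b U) = HEscale (a * b) U.
Proof. by rewrite -[U]repK !HEscale_class scalerA. Qed.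
Fact HEscale1 : left_id 1 HEscale.
Proof. by move=> U; rewrite -[U]repK HEscale_class scale1r. Qed.
Fact HEscaleDr : right_distributive HEscale +%R.
Proof.
move=> a U V; rewrite -[U]repK -[V]repK -class_ofD !HEscale_class.
by rewrite scalerDr class_ofD.
Qed.
Fact HEscaleDl U : {morph HEscale^~ U : a b / a + b}.
Proof.
by move=> a b; rewrite -[U]repK !HEscale_class scalerDl class_ofD.
Qed.
HB.instance Definition _ := GRing.Zmodule_isLmodule.Build R HE
  HEscaleA HEscale1 HEscaleDr HEscaleDl.

Lemma class_ofZ a u : class_of (a *: u) = a *: class_of u.
Proof. by rewrite -HEscale_class. Qed.

Definition HEdot U V : R := energy N (rep U) (rep V).

Lemma HEdotC U V : HEdot U V = HEdot V U.
Proof. exact: energyC. Qed.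

Let finEe u : finite_energy N u. Proof. by have /asboolP := finEP u. Qed.

Lemma HEdot_class u v : HEdot (class_of u) (class_of v) = energy N u v.
Proof.
have [[a ua] [b vb]] := (rep_class u, rep_class v).
rewrite /HEdot; congr (_ * rsum _); apply/funext => xy.
by rewrite /energy_term !ua !vb; ring.
Qed.

Lemma HEdotDl U V W : HEdot (U + V) W = HEdot U W + HEdot V W.
Proof.
rewrite -[U]repK -[V]repK -[W]repK -class_ofD !HEdot_class.
exact: energyDl (finEe _) (finEe _) (finEe _).
Qed.

Lemma HEdotZl a U V : HEdot (a *: U) V = a * HEdot U V.
Proof.
rewrite -[U]repK -[V]repK -class_ofZ !HEdot_class.
exact: energyZl (finEe _) (finEe _).
Qed.

Lemma HEdot_ge0 U : 0 <= HEdot U U.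
Proof. exact: energy_ge0. Qed.

Lemma HEdot_eq0 U : HEdot U U = 0 -> U = 0.
Proof.
move=> /energy_eq0 -/(_ (finEe _))[a e]; rewrite -[U]repK.
have -> : 0 = class_of 0 :> HE by rewrite class_of0.
by apply/class_ofP; exists a; rewrite subr0.
Qed.

Definition HEnorm U : R := Num.sqrt (HEdot U U).

Lemma HEdot_CS U V : HEdot U V <= HEnorm U * HEnorm V.
Proof.
have DZ a : HEdot (U + a *: V) (U + a *: V) =
    HEdot U U + 2 * a * HEdot U V + a ^+ 2 * HEdot V V.
  rewrite HEdotDl HEdotZl ![HEdot _ (_ + _)]HEdotC !HEdotDl !HEdotZl.
  by rewrite [HEdot V U]HEdotC; ring.
have [V0|V0] := eqVneq (HEdot V V) 0.
  rewrite (HEdot_eq0 V0) HEdotC -[X in HEdot X U](scale0r 0) HEdotZl mul0r.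
  by rewrite mulr_ge0// sqrtr_ge0.
have Vp : 0 < HEdot V V by rewrite lt_def V0 HEdot_ge0.
apply: le_trans (ler_norm _) _; rewrite /HEnorm -sqrtrM ?HEdot_ge0//.
rewrite -sqrtr_sqr ler_wsqrtr//.
have := HEdot_ge0 (U + (- HEdot U V / HEdot V V) *: V); rewrite DZ.
rewrite -(pmulr_lge0 _ Vp) -subr_ge0.
have -> : (HEdot U U + 2 * (- HEdot U V / HEdot V V) * HEdot U V +
  (- HEdot U V / HEdot V V) ^+ 2 * HEdot V V) * HEdot V V =
  HEdot U U * HEdot V V - HEdot U V ^+ 2 by field.
by rewrite subr0 subr_ge0.
Qed.

Fact HEnormD U V : HEnorm (U + V) <= HEnorm U + HEnorm V.
Proof.
have n0 X : 0 <= HEnorm X by rewrite sqrtr_ge0.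
have sq X : HEnorm X ^+ 2 = HEdot X X by rewrite sqr_sqrtr ?HEdot_ge0.
rewrite -(@ler_pXn2r _ 2)// ?nnegrE ?addr_ge0// sqrrD !sq.
rewrite HEdotDl ![HEdot _ (U + V)]HEdotC !HEdotDl [HEdot V U]HEdotC.
have := HEdot_CS U V; set p := HEdot U V; lra.
Qed.

Fact HEnormZ (a : R) U : HEnorm (a *: U) = `|a| * HEnorm U.
Proof.
rewrite /HEnorm HEdotZl HEdotC HEdotZl mulrA -expr2 sqrtrM ?sqr_ge0//.
by rewrite sqrtr_sqr.
Qed.

Fact HEnorm_eq0 U : HEnorm U = 0 -> U = 0.
Proof.
move=> /eqP; rewrite sqrtr_eq0 => U0; apply: HEdot_eq0.
by apply/eqP; rewrite eq_le U0 HEdot_ge0.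
Qed.

HB.instance Definition _ :=
  Lmodule_isNormed.Build R HE HEnormD HEnormZ HEnorm_eq0.
HB.instance Definition _ := isInnerProduct.Build R HE
  HEdotC HEdotDl HEdotZl (fun=> erefl).

(* u(x) - u(y), which does not depend on the representative *)
Definition potential_drop U (x y : G) : R := rep U x - rep U y.

End EnergySpace.

Section Operators.
Context {R : realType} {V : innerProductType R}.
Implicit Types (A : set V) (D : set (V * V)).

Definition lspan A : set V := [set v | exists n (a : 'I_n -> R) (x : 'I_n -> V),
  (forall i, A (x i)) /\ v = \sum_i a i *: x i].

Definition orthocomp A : set V := [set h | forall x, A x -> dot x h = 0].

Definition is_projection A (x p : V) : Prop := A p /\ orthocomp A (x - p).

(* The value of an operator outside its domain is irrelevant. *)
Record operator := Operator {
  op_dom : set V;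
  op_fun :> V -> V;
  op_dom0 : op_dom 0;
  op_dom_linear : forall (a : R) u v,
    op_dom u -> op_dom v -> op_dom (a *: u + v);
  op_linear : forall (a : R) u v, op_dom u -> op_dom v ->
    op_fun (a *: u + v) = a *: op_fun u + op_fun v
}.

Definition op_graph (L : operator) : set (V * V) :=
  [set uv | op_dom L uv.1 /\ uv.2 = L uv.1].

Definition adjoint D : set (V * V) :=
  [set vw | forall x y, D (x, y) -> dot y vw.1 = dot x vw.2].

Definition self_adjoint (L : operator) : Prop :=
  dense (op_dom L) /\ adjoint (op_graph L) = op_graph L.

Definition bounded_graph D : Prop :=
  exists C : R, forall x y, D (x, y) -> `|y| <= C * `|x|.

Definition gram_schmidt (v e : nat -> V) : Prop := forall n,
  let w := v n - \sum_(i < n) dot (v n) (e i) *: e i in e n = `|w|^-1 *: w.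

(* e 0, e 1, ... play the role of epsilon_1, epsilon_2, ... *)
Definition diagonal_graph (e : nat -> V) : set (V * V) :=
  [set uv | exists n (a : 'I_n -> R), uv =
    (\sum_(i < n) a i *: e i, \sum_(i < n) (i.+1%:R * a i) *: e i)].

Definition op_power_dom (L : operator) (p : nat) : set V :=
  [set u | forall i, (i < p)%N -> op_dom L (iter i L u)].

End Operators.

Arguments operator {R} V.

Section SmoothVectors.
Context {R : realType} {V : innerProductType R} (L : operator V).

Definition smooth_pred : {pred V} :=
  fun u => `[< (\bigcap_(p in [set p | (1 <= p)%N]) op_power_dom L p) u >].

Lemma smooth_predP u : u \in smooth_pred <-> forall i, op_dom L (iter i L u).
Proof.
split=> [/asboolP us i|us]; first exact: (us i.+1).
by apply/asboolP => p _ i _; exact: us.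
Qed.

Lemma iter_op_linear (a : R) u v i :
  (forall i, op_dom L (iter i L u)) -> (forall i, op_dom L (iter i L v)) ->
  iter i L (a *: u + v) = a *: iter i L u + iter i L v.
Proof. by move=> us vs; elim: i => //= i ->; rewrite op_linear. Qed.

Fact smooth_submod : submod_closed smooth_pred.
Proof.
split.
  apply/smooth_predP => i; suff -> : iter i L 0 = 0 by exact: op_dom0.
  elim: i => //= i ->; have := op_linear (-1) (op_dom0 L) (op_dom0 L).
  by rewrite !scaleN1r !addNr.
move=> a u v /smooth_predP us /smooth_predP vs; apply/smooth_predP => i.
by rewrite iter_op_linear//; exact: op_dom_linear.
Qed.
HB.instance Definition _ :=
  GRing.isSubmodClosed.Build R V smooth_pred smooth_submod.

Record smooth := Smooth { smooth_val :> V; smoothP : smooth_val \in smooth_pred }.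
HB.instance Definition _ := [isSub for smooth_val].
HB.instance Definition _ := [Choice of smooth by <:].
HB.instance Definition _ := [SubChoice_isSubLmodule of smooth by <:].

Definition smooth_incl : smooth -> V := val.
Fact smooth_incl_linear : linear smooth_incl. Proof. by []. Qed.
HB.instance Definition _ :=
  GRing.isLinear.Build R smooth V _ smooth_incl smooth_incl_linear.

Definition op_power (p : nat) (u : smooth) : V := iter p L (smooth_incl u).

Fact op_power_linear p : linear (op_power p).
Proof.
move=> a u v; rewrite /op_power linearP iter_op_linear//.
  exact/smooth_predP/(smoothP u).
exact/smooth_predP/(smoothP v).
Qed.
HB.instance Definition _ p :=
  GRing.isLinear.Build R smooth V _ (op_power p) (op_power_linear p).

(* The locally convex topology defined by the seminorms |L^p u|, p = 0, 1, ... *)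
Definition seminorm_ball (u : smooth) (n : nat) (e : R) : set smooth :=
  [set w | forall p, (p <= n)%N -> `|op_power p (w - u)| < e].

Definition smooth_nbhs (u : smooth) : set (set smooth) :=
  [set U | exists n, exists2 e : R, 0 < e & seminorm_ball u n e `<=` U].

HB.instance Definition _ := hasNbhs.Build smooth smooth_nbhs.

Lemma seminorm_ball_center u n e : 0 < e -> seminorm_ball u n e u.
Proof. by move=> e0 p _; rewrite subrr linear0 normr0. Qed.

Lemma smooth_nbhsE (u : smooth) U :
  nbhs u U <-> exists n, exists2 e : R, 0 < e & seminorm_ball u n e `<=` U.
Proof. by []. Qed.

Lemma seminorm_ball_nbhs u n e : 0 < e -> nbhs u (seminorm_ball u n e).
Proof. by move=> e0; exists n, e. Qed.

Lemma seminorm_ball_room u n e w : seminorm_ball u n e w ->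
  exists2 d : R, 0 < d & seminorm_ball w n d `<=` seminorm_ball u n e.
Proof.
move=> uw; suff [d d0 dP] : exists2 d : R, 0 < d &
    forall p, (p <= n)%N -> `|op_power p (w - u)| + d <= e.
  exists d => // z wz p pn.
  have -> : z - u = (z - w) + (w - u) by rewrite addrA subrK.
  rewrite linearD (le_lt_trans (ler_normD _ _))// (lt_le_trans _ (dP p pn))//.
  by rewrite addrC ltrD2l wz.
elim: n uw => [|n IH] uw.
  exists (e - `|op_power 0 (w - u)|); first by rewrite subr_gt0 uw.
  by move=> p; rewrite leqn0 => /eqP ->; rewrite addrC subrK.
have [|d d0 dP] := IH; first by move=> p pn; apply: uw; exact: leqW.
exists (Num.min d (e - `|op_power n.+1 (w - u)|)).
  by rewrite lt_min d0 subr_gt0 uw.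
move=> p; rewrite leq_eqVlt => /predU1P[->|pn].
  by rewrite -lerBrDl ge_min lexx orbT.
by rewrite (le_trans _ (dP p pn))// lerD2l ge_min lexx.
Qed.

Fact smooth_nbhs_filter (u : smooth) : ProperFilter (nbhs u).
Proof.
apply: Build_ProperFilter_ex.
  by move=> U [n [e e0 UP]]; exists u; exact/UP/seminorm_ball_center.
split; first by exists 0%N, 1.
  move=> U W [n [e e0 UP]] [m [d d0 WP]].
  exists (maxn n m), (Num.min e d); first by rewrite lt_min e0 d0.
  move=> w uw; split; [apply: UP|apply: WP] => p pn.
    by have := uw p (leq_trans pn (leq_maxl _ _)); rewrite lt_min => /andP[].
  by have := uw p (leq_trans pn (leq_maxr _ _)); rewrite lt_min => /andP[].
by move=> U W UW [n [e e0 UP]]; exists n, e => //; exact: subset_trans UW.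
Qed.

Fact smooth_nbhs_singleton (u : smooth) U : nbhs u U -> U u.
Proof. by move=> [n [e e0 UP]]; exact/UP/seminorm_ball_center. Qed.

Fact smooth_nbhs_nbhs (u : smooth) U : nbhs u U -> nbhs u (nbhs^~ U).
Proof.
move=> [n [e e0 UP]]; exists n, e => // w /seminorm_ball_room[d d0 dP].
by exists n, d => //; exact: subset_trans UP.
Qed.

HB.instance Definition _ := Nbhs_isNbhsTopological.Build smooth
  smooth_nbhs_filter smooth_nbhs_singleton smooth_nbhs_nbhs.

Fact smooth_add_continuous : continuous (fun x : smooth * smooth => x.1 + x.2).
Proof.
move=> [u v] U [n [e e0 UP]].
have e20 : 0 < e / 2 by rewrite divr_gt0.
exists (seminorm_ball u n (e / 2), seminorm_ball v n (e / 2)).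
  by split; exact: seminorm_ball_nbhs.
move=> [x y] [/= ux vy]; apply: UP => p pn /=.
rewrite opprD addrACA linearD (le_lt_trans (ler_normD _ _))//.
by rewrite [ltRHS]splitr ltrD ?ux ?vy.
Qed.

Lemma op_power_bound (u : smooth) n :
  exists2 M : R, 0 < M & forall p, (p <= n)%N -> `|op_power p u| <= M.
Proof.
elim: n => [|n [M M0 MP]].
  exists (`|op_power 0 u| + 1); first by rewrite ltr_wpDl.
  by move=> p; rewrite leqn0 => /eqP ->; rewrite lerDl.
exists (Num.max M `|op_power n.+1 u|); first by rewrite lt_max M0.
move=> p; rewrite leq_eqVlt => /predU1P[->|pn]; first by rewrite le_max lexx orbT.
by rewrite le_max MP.
Qed.

Fact smooth_scale_continuous : continuous (fun z : R^o * smooth => z.1 *: z.2).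
Proof.
move=> [a u] U [n [e e0 UP]].
have [M M0 MP] := op_power_bound u n.
pose d := Num.min 1 (e / (2 * (`|a| + 1))).
have a1 : 0 < `|a| + 1 by rewrite ltr_wpDl.
have d0 : 0 < d by rewrite lt_min ltr01 divr_gt0// mulr_gt0.
pose r := Num.min 1 (e / (2 * M)).
have r0 : 0 < r by rewrite lt_min ltr01 divr_gt0// mulr_gt0.
exists (ball (a : R^o) r, seminorm_ball u n d).
  by split; [exact: nbhsx_ballx|exact: seminorm_ball_nbhs].
move=> [b w] [/= ab uw]; apply: UP => p pn /=.
have {ab} : `|b - a| < r by rewrite distrC.
rewrite lt_min => /andP[ab1 abM].
have b1 : `|b| <= `|a| + 1.
  rewrite -(subrK a b) addrC (le_trans (ler_normD _ _))// lerD2l.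
  exact: ltW.
have -> : b *: w - a *: u = b *: (w - u) + (b - a) *: u.
  by rewrite scalerBr scalerBl addrA subrK.
rewrite linearD !linearZ (le_lt_trans (ler_normD _ _))// [ltRHS]splitr.
have := uw p pn; rewrite lt_min => /andP[_ uwd].
rewrite !normrZ ltr_leD//.
  apply: (@le_lt_trans _ _ ((`|a| + 1) * `|op_power p (w - u)|)).
    by rewrite ler_wpM2r.
  have := uwd; rewrite -(ltr_pM2l a1) => /lt_le_trans; apply.
  rewrite le_eqVlt; apply/orP; left; apply/eqP.
  by field; rewrite gt_eqF.
apply: (@le_trans _ _ (`|b - a| * M)); first by rewrite ler_wpM2l ?MP.
have := ltW abM; rewrite -(ler_pM2r M0) => /le_trans; apply.
rewrite le_eqVlt; apply/orP; left; apply/eqP.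
by field; rewrite gt_eqF.
Qed.

Local Open Scope convex_scope.

Fact smooth_locally_convex : exists2 B : set_system smooth,
  (forall b, b \in B -> convex_set b) & basis B.
Proof.
exists [set U | exists u n e, 0 < e /\ U = seminorm_ball u n e].
  move=> U; rewrite inE => -[u [n [e [e0 ->]]]].
  apply/convex_setW => x y; rewrite !inE => ux uy l l0 l1.
  rewrite inE => p pn.
  rewrite [X in `|X|](_ : _ = l%:num *: op_power p (x - u) + (1 - l%:num) *: op_power p (y - u)); last first.
    rewrite -!linearZ -linearD !scalerBr addrACA -opprD -scalerDl subrKC scale1r.
    by [].
  rewrite (le_lt_trans (ler_normD _ _))// !normrZ.
  rewrite (ger0_norm (ltW l0)) ger0_norm ?subr_ge0 ?(ltW l1)//.
  have -> : e = l%:num * e + (1 - l%:num) * e by rewrite -mulrDl subrKC mul1r.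
  by rewrite ltrD// ltr_pM2l ?subr_gt0// ?ux ?uy.
split.
  move=> U [u [n [e [e0 ->]]]]; rewrite openE => w /seminorm_ball_room[d d0 dP].
  by exists n, d.
move=> u U [n [e e0 UP]]; exists (seminorm_ball u n e) => //.
split; first by exists u, n, e.
exact: seminorm_ball_center.
Qed.

HB.instance Definition _ := PreTopologicalLmod_isTvs.Build R smooth
  smooth_add_continuous smooth_scale_continuous smooth_locally_convex.
(* The factory above only installs the translation-invariant uniformity. *)
HB.instance Definition _ := PreTopologicalNmodule_isTopologicalNmodule.Build
  smooth smooth_add_continuous.
HB.instance Definition _ := TopologicalNmodule_isTopologicalLmodule.Build
  R smooth smooth_scale_continuous.
HB.instance Definition _ := Uniform_isTvs.Build R smooth smooth_locally_convex.

End SmoothVectors.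

Definition frechet_space {R : realType} (E : tvsType R) : Prop :=
  [/\ hausdorff_space E, countable_uniformity E &
      forall F : set_system E, ProperFilter F -> cauchy F -> exists u : E, F --> u].

Section GelfandTriples.
Context {R : realType} {V : innerProductType R} {E : tvsType R}.
Implicit Types (i : {linear E -> V}) (f : {linear E -> R^o}).

Definition topological_dual : set {linear E -> R^o} :=
  [set f | continuous f].

(* The topology of E compared with the one induced by V through i *)
Definition strictly_finer i : Prop :=
  (forall W : set V, open W -> open (i @^-1` W)) /\
  exists2 U : set E, open U & forall W : set V, open W -> i @^-1` W <> U.

Definition riesz i (v : V) : E -> R^o := fun u => dot (i u) v.
Fact riesz_linear i v : linear (riesz i v).
Proof. by move=> a x y; rewrite /riesz linearP dotDl dotZl. Qed.
HB.instance Definition _ i v :=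
  GRing.isLinear.Build R E R^o _ (riesz i v) (riesz_linear i v).

Definition gelfand_triple i : Prop :=
  [/\ injective i /\ dense (range i),
      frechet_space E,
      strictly_finer i /\ continuous i,
      range i <> [set: V] &
      [/\ forall v, topological_dual (riesz i v),
          forall v w, riesz i v =1 riesz i w -> v = w &
          exists2 f, topological_dual f & forall v, ~ (f =1 riesz i v)]].

Definition pairing (u : E) f : R := f u.

End GelfandTriples.

Arguments riesz {R V} E i v.
Arguments gelfand_triple {R V} E i.
Arguments smooth_incl {R V} L u.

(* w is the element written L^{-p} f: phi is the extension to V of the
   functional L^p s |-> f s. *)
Definition is_neg_power {R : realType} {V : innerProductType R}
    (L : operator V) (p : nat) (f : {linear smooth L -> R^o}) (w : V) : Prop :=
  exists phi : {linear V -> R^o},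
    [/\ continuous phi,
        forall s, phi (op_power p s) = f s,
        forall h, orthocomp (closure (range (@op_power _ _ L p))) h -> phi h = 0 &
        forall h, phi h = dot h w].

Section Constructions.
Context {R : realType} {G : choiceType} (N : network R G) (o : G).
Implicit Types (v f : G -> HE N) (w : HE N).

Definition is_energy_kernel v : Prop := forall x U, dot (v x) U = potential_drop U x o.

Definition delta (x : G) : HE N :=
  class_of (FinE (asboolT (finite_energy_indic1 N x))).

Definition Fin : set (HE N) := closure (lspan (range delta)).

Definition monopole (x : G) w : Prop := laplacian N (rep w) = indic1 x.

(* Empty if there are no monopoles *)
Definition minimal_monopole w : Prop :=
  monopole o w /\ forall w', monopole o w' -> dot w w <= dot w' w'.

Definition laplacian_graph (D : set (HE N)) : set (HE N * HE N) :=
  [set UW | D UW.1 /\ exists2 h : finE N, class_of h = UW.2 &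
    h = laplacian N (rep UW.1) :> (G -> R)].

Definition dom_M v f : set (HE N) :=
  [set a + b | a in lspan (range v) &
    b in lspan [set u | exists x w, minimal_monopole w /\
                                    (u = v x + w \/ u = f x + w)]].

Definition laplacian_M v f : set (HE N * HE N) :=
  closure (laplacian_graph (dom_M v f)).

(* x 0, x 1, ... is the enumeration x_1, x_2, ...; L is the closure of the
   diagonal operator, which makes it self-adjoint. *)
Definition constructionA (L : operator (HE N)) : Prop :=
  exists v (x : nat -> G) (e : nat -> HE N),
    [/\ is_energy_kernel v,
        set_bij [set: nat] (~` [set o]) x,
        gram_schmidt (v \o x) e &
        op_graph L = closure (diagonal_graph e)].

Definition constructionB (L : operator (HE N)) : Prop :=
  exists v f,
    [/\ is_energy_kernel v,
        forall x, is_projection Fin (v x) (f x),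
        ~ bounded_graph (laplacian_M v f),
        self_adjoint L &
        laplacian_M v f `<=` op_graph L].

End Constructions.

(* Main.v *)
Require Import Defs.
From HB Require Import structures.
From mathcomp Require Import all_boot all_order all_algebra.
From mathcomp Require Import ring lra.
From mathcomp Require Import all_classical all_reals all_analysis.

Set Implicit Arguments.
Unset Strict Implicit.
Unset Printing Implicit Defensive.

Import Order.TTheory GRing.Theory Num.Theory.
Import numFieldNormedType.Exports.

Local Open Scope classical_set_scope.
Local Open Scope ring_scope.

(** In both constructions [L] is an unbounded self-adjoint operator on a Hilbert
    space, and nothing else about the network is used. For (A), the basis is
    orthonormal and total because the [v_x], [x <> o], are linearly independent
    ([<v_x, delta_y>] is [1] if [x = y] and [0] otherwise) and separate
    functions modulo constants; the closed diagonal operator is then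
    multiplication by [n] on Fourier coefficients.

    Let [B = (1 + L^2)^-1], a bounded symmetric injection with dense range that
    commutes with [L]. A vector with an infinite chain of [B]-preimages is
    smooth, and a Mittag-Leffler argument shows that such vectors are dense.
    By Hellinger-Toeplitz the domain of [L] is not the whole space; hence the
    smooth vectors and the range of [B] are proper subspaces, and for [y]
    outside the range of [B] the functional [u |-> <(1 + L^2) u, y>] is
    continuous on the smooth vectors but not represented in the Hilbert space.
    Finally [L^-p v] is the Riesz representative, in the closure of the range of
    [L^p], of [L^p u |-> v u]. *)

(** * Real inner product spaces *)

Section InnerProductTheory.
Context {R : realType} {V : innerProductType R}.
Implicit Types u v w : V.

Lemma dotDr u v w : dot u (v + w) = dot u v + dot u w.
Proof. by rewrite dotC dotDl !(dotC u). Qed.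

Lemma dotZr (a : R) u v : dot u (a *: v) = a * dot u v.
Proof. by rewrite dotC dotZl (dotC u). Qed.

Lemma dot0l v : dot 0 v = 0.
Proof. by have := dotZl 0 0 v; rewrite scale0r mul0r. Qed.

Lemma dot0r v : dot v 0 = 0.
Proof. by rewrite dotC dot0l. Qed.

Lemma dotNl u v : dot (- u) v = - dot u v.
Proof. by rewrite -scaleN1r dotZl mulN1r. Qed.

Lemma dotNr u v : dot u (- v) = - dot u v.
Proof. by rewrite dotC dotNl dotC. Qed.

Lemma dotBl u v w : dot (u - v) w = dot u w - dot v w.
Proof. by rewrite dotDl dotNl. Qed.

Lemma dotBr u v w : dot u (v - w) = dot u v - dot u w.
Proof. by rewrite dotDr dotNr. Qed.

Lemma dot_suml n (F : 'I_n -> V) v :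
  dot (\sum_(i < n) F i) v = \sum_(i < n) dot (F i) v.
Proof.
elim: n F => [|n IH] F; first by rewrite !big_ord0 dot0l.
by rewrite !big_ord_recr /= dotDl IH.
Qed.

(** The mixin does not postulate positivity. A negative [dot u u] would have square root [0] by
    convention, so [u] would have norm [0] and vanish. *)
Lemma dot_ge0 u : 0 <= dot u u.
Proof.
rewrite leNgt; apply/negP => u0.
have /normr0_eq0 u00 : `|u| = 0 by rewrite normr_dot ler0_sqrtr// ltW.
by move: u0; rewrite u00 dot0l ltxx.
Qed.

Lemma dotvv u : dot u u = `|u| ^+ 2.
Proof. by rewrite normr_dot sqr_sqrtr// dot_ge0. Qed.

Lemma dotvv_eq0 u : dot u u = 0 -> u = 0.
Proof. by rewrite dotvv => /eqP; rewrite sqrf_eq0 normr_eq0 => /eqP. Qed.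

Lemma dot_le_norm u v : `|dot u v| <= `|u| * `|v|.
Proof.
have [->|v0] := eqVneq v 0; first by rewrite dot0r !normr0 mulr0.
have vp : 0 < `|v| ^+ 2 by rewrite exprn_gt0// normr_gt0.
rewrite -(@ler_pXn2r _ 2)// ?nnegrE ?mulr_ge0// real_normK ?num_real// exprMn.
have := dot_ge0 (u - (dot u v / `|v| ^+ 2) *: v).
rewrite dotBl !dotBr dotZl !dotZr dotZl (dotC v u) !dotvv.
rewrite -(pmulr_rge0 _ vp); set a := dot u v; set b := `|u| ^+ 2.
have -> : `|v| ^+ 2 * (b - a / `|v| ^+ 2 * a - (a / `|v| ^+ 2 * a -
   a / `|v| ^+ 2 * (a / `|v| ^+ 2 * `|v| ^+ 2))) = b * `|v| ^+ 2 - a ^+ 2.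
  by field; rewrite normr_eq0.
by rewrite subr_ge0.
Qed.

Lemma norm_le_sqr u (a : R) : 0 <= a -> dot u u <= a ^+ 2 -> `|u| <= a.
Proof. by move=> a0; rewrite dotvv ler_pXn2r// nnegrE. Qed.

Definition dotr w : V -> R^o := dot^~ w.

Fact dotr_linear w : linear (dotr w).
Proof. by move=> a u v; rewrite /dotr dotDl dotZl. Qed.
HB.instance Definition _ w :=
  GRing.isLinear.Build R V R^o _ (dotr w) (dotr_linear w).

Lemma linear_le_continuous (U W : normedModType R) (f : {linear U -> W}) (K : R) :
  (forall x, `|f x| <= K * `|x|) -> continuous f.
Proof.
move=> fK; apply/linear_bounded_continuous/linear_boundedP.
near=> r => x; rewrite (le_trans (fK x))// ler_wpM2r//.
Unshelve. all: by end_near. Qed.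

Lemma dotr_continuous w : continuous (dotr w).
Proof.
apply: (@linear_le_continuous _ _ (dotr w) `|w|) => x.
by rewrite mulrC; exact: dot_le_norm.
Qed.

Lemma cvg_dotl (I : Type) (F : set_system I) (g : I -> V) x w :
  g @ F --> x -> (fun i => dot (g i) w : R) @ F --> (dot x w : R).
Proof. by move=> gx; exact: cvg_comp gx (@dotr_continuous w x). Qed.

Lemma cvg_dotr (I : Type) (F : set_system I) (g : I -> V) x w :
  g @ F --> x -> (fun i => dot w (g i) : R) @ F --> (dot w x : R).
Proof.
move=> gx; rewrite (_ : (fun i => dot w (g i)) = (fun i => dot (g i) w)).
  by rewrite dotC; exact: cvg_dotl.
by apply/funext => i; rewrite dotC.
Qed.

End InnerProductTheory.

(** * Minimizing a quadratic functional *)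

Section Minimizing.
Context {R : realType} (E : lmodType R) (D : set E) (a : E -> E -> R) (f : E -> R).
Hypothesis D_linear : forall r u v, D u -> D v -> D (r *: u + v).
Hypothesis aC : forall u v, D u -> D v -> a u v = a v u.
Hypothesis a_linear : forall r u v w, D u -> D v -> D w ->
  a (r *: u + v) w = r * a u w + a v w.
Hypothesis a_ge0 : forall u, D u -> 0 <= a u u.
Hypothesis f_linear : forall r u v, D u -> D v -> f (r *: u + v) = r * f u + f v.

Let aD r u v : D u -> D v ->
  a (r *: u + v) (r *: u + v) = r ^+ 2 * a u u + 2 * r * a u v + a v v.
Proof.
move=> Du Dv; have Dw := D_linear r Du Dv.
rewrite a_linear// ![a _ (_ + _)]aC// !a_linear// (aC Dv Du); ring.
Qed.

(* Riesz's argument: [x] minimizes [a u u - 2 * f u]. It is stated for a form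
   because it is applied both to the inner product and to a graph norm. *)
Lemma minimizing_sequence (K : R) : D 0 -> 0 <= K ->
  (forall u, D u -> f u ^+ 2 <= K * a u u) ->
  exists2 x : nat -> E, forall n, D (x n) &
    (forall m n, a (x m - x n) (x m - x n) <= 2 * (m.+1%:R^-1 + n.+1%:R^-1)) /\
    (forall u n, D u -> (a u (x n) - f u) ^+ 2 <= a u u * n.+1%:R^-1).
Proof.
move=> D0 K0 fK; pose J u := a u u - 2 * f u.
have J_ge u : D u -> - K <= J u.
  move=> Du; have := fK u Du; have := a_ge0 Du; rewrite /J.
  set q := a u u; set b := f u => q0 bq.
  suff : 2 * b <= q + K by lra.
  apply: le_trans (ler_norm _) _.
  rewrite -(@ler_pXn2r _ 2)// ?nnegrE ?addr_ge0// real_normK ?num_real//.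
  have -> : (q + K) ^+ 2 = (q - K) ^+ 2 + 4 * (K * q) by ring.
  by have := sqr_ge0 (q - K); rewrite exprMn; lra.
have infJ : has_inf (J @` D).
  by split; [exists (J 0), 0|exists (- K) => _ [u Du <-]; exact: J_ge].
set mu := inf (J @` D).
have mu_le u : D u -> mu <= J u.
  by move=> Du; apply: ge_inf; [exact: infJ.2|exists u].
have /choice[x xP] n : exists x, D x /\ J x < mu + n.+1%:R^-1.
  have n0 : 0 < n.+1%:R^-1 :> R by rewrite invr_gt0.
  have [_ [u Du <-] Ju] := inf_adherent n0 infJ.
  by exists u.
exists x; first by move=> n; case: (xP n).
split.
  move=> m n; have [[Dm Jm] [Dn Jn]] := (xP m, xP n).
  have Dd : D (- 1 *: x n + x m) by exact: D_linear.
  (* The point compared with the infimum is the midpoint of [x m] and [x n]; the parallelogram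
     identity then bounds the form on their difference. *)
  have := mu_le _ (D_linear 2^-1 Dd Dn).
  have -> : x m - x n = - 1 *: x n + x m by rewrite scaleN1r addrC.
  move: Jm Jn; rewrite /J aD// !f_linear// !aD// a_linear// (aC Dm Dn).
  rewrite exprVn; set e := m.+1%:R^-1; set d := n.+1%:R^-1 => Jm Jn.
  lra.
move=> u n Du; have [Dn Jn] := xP n; set e : R := n.+1%:R^-1.
have e0 : 0 < e by rewrite invr_gt0.
(* Moving from [x n] to [t *: u + x n] lowers [J] by at most [e]. This quadratic inequality in [t]
   is used at its vertex, or at [t = - e / b] when it degenerates to a linear one. *)
have JD t : - e <= t ^+ 2 * a u u + 2 * t * (a u (x n) - f u).
  have := mu_le _ (D_linear t Du Dn); move: Jn; rewrite /J aD// f_linear// -/e.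
  set r := t ^+ 2 * _; set s := a u (x n); set z := f u.
  have -> : 2 * t * (s - z) = 2 * t * s - 2 * (t * z) by ring.
  rewrite mulrDr; lra.
move: JD; set b := a u (x n) - f u => JD.
have := a_ge0 Du; rewrite le_eqVlt => /predU1P[A0|A0].
  have [->|b0] := eqVneq b 0; first by rewrite expr0n -A0 mul0r.
  have := JD (- e / b); rewrite -A0 mulr0 add0r mulrA mulfVK//; lra.
have := JD (- b / a u u); rewrite -(ler_pM2r A0).
have -> : ((- b / a u u) ^+ 2 * a u u + 2 * (- b / a u u) * b) * a u u = - b ^+ 2.
  by field; rewrite gt_eqF.
by rewrite mulNr lerN2 mulrC.
Qed.

End Minimizing.

(** * Hilbert spaces: convergence criteria, Riesz representation, density *)

#[short(type="hilbertType")]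
HB.structure Definition Hilbert (R : realType) :=
  {V of InnerProduct R V & Complete V}.

Section HilbertTheory.
Context {R : realType} {V : hilbertType R}.


Lemma cauchy_seq_cvg (y : nat -> V) :
  (forall e : R, 0 < e -> exists k, forall m n, (k <= m)%N -> (k <= n)%N ->
    `|y m - y n| < e) -> cvg (y @ \oo).
Proof.
move=> yP; apply/cauchy_cvgP/cauchy_ballP => e e0.
have [k kP] := yP e e0.
exists (y @` [set n | (k <= n)%N], y @` [set n | (k <= n)%N]).
  by split => /=; exists k => // n kn; exists n.
move=> [_ _] [/= [m km <-] [n kn <-]]; rewrite -ball_normE /=.
exact: kP.
Qed.

Lemma cvg_of_sqr_bound (y : nat -> V) :
  (forall m n, dot (y m - y n) (y m - y n) <= 2 * (m.+1%:R^-1 + n.+1%:R^-1)) ->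
  cvg (y @ \oo).
Proof.
move=> yP; apply: cauchy_seq_cvg => e e0.
have e2 : 0 < e ^+ 2 / 4 by rewrite divr_gt0// exprn_gt0.
have [k _ kP] := near_infty_natSinv_lt (PosNum e2).
exists k => m n km kn; rewrite -(@ltr_pXn2r _ 2)// ?nnegrE ?(ltW e0)//.
rewrite -dotvv (le_lt_trans (yP m n))//.
have /= := kP m km; have /= := kP n kn.
set p := m.+1%:R^-1; set q := n.+1%:R^-1; lra.
Qed.

Lemma geometric_seq_cvg (s : nat -> V) (c : R) : 0 <= c ->
  (forall n, `|s n.+1 - s n| <= c / 2 ^+ n) ->
  exists2 l, s @ \oo --> l & `|l - s 0%N| <= 2 * c.
Proof.
move=> c0 sc.
(* The exact geometric sum, rather than its bound [2 * c / 2 ^+ k], is what makes the induction on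
   [m] close. *)
have sm k m : `|s (k + m)%N - s k| <= 2 * c / 2 ^+ k - 2 * c / 2 ^+ (k + m).
  elim: m => [|m IH]; first by rewrite addn0 !subrr normr0.
  rewrite -(subrKA (s (k + m)%N)) (le_trans (ler_normD _ _))// addnS.
  have := sc (k + m)%N; rewrite exprS invfM.
  move: IH; set q := (2 ^+ (k + m))^-1.
  by set z := 2 * c / 2 ^+ k; have -> : 2 * c * (2^-1 * q) = c * q by [field]; lra.
have sm' k m : (k <= m)%N -> `|s m - s k| <= 2 * c / 2 ^+ k.
  move=> km; rewrite -(subnKC km) (le_trans (sm _ _))// gerBl.
  by rewrite divr_ge0 ?mulr_ge0// exprn_ge0.
have /cvg_ex[l sl] : cvg (s @ \oo).
  apply: cauchy_seq_cvg => e e0.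
  have c4 : 0 < e / (4 * c + 1) by rewrite divr_gt0// ltr_wpDl// mulr_ge0.
  have [k _ kP] := near_infty_natSinv_lt (PosNum c4).
  have {kP} /= kP := kP k (leqnn k).
  have k2 : 2 * c / 2 ^+ k <= 2 * c * k.+1%:R^-1.
    rewrite ler_wpM2l ?mulr_ge0// lef_pV2 ?posrE ?exprn_gt0//.
    by rewrite -natrX ler_nat ltn_expl.
  have k3 : 2 * (2 * c * k.+1%:R^-1) < e.
    rewrite !mulrA -natrM; apply: le_lt_trans (_ : (4 * c + 1) * k.+1%:R^-1 < e).
      by rewrite ler_wpM2r ?invr_ge0// lerDl.
    by rewrite mulrC -ltr_pdivlMr// ltr_wpDl// mulr_ge0.
  exists k => m n km kn; rewrite -(subrKA (s k)) (le_lt_trans (ler_normD _ _))//.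
  rewrite (distrC (s k)) (le_lt_trans (lerD (sm' _ _ km) (sm' _ _ kn)))//.
  by move: k2 k3; set p := 2 * c / _; set q := 2 * c * _ => *; lra.
exists l => //; have cv : (fun n => `|s n - s 0%N|) @ \oo --> `|l - s 0%N|.
  by apply: cvg_norm; exact: (cvgB sl (cvg_cst _)).
rewrite -(cvg_lim (@Rhausdorff R) cv); apply: limr_le.
  by apply/cvg_ex; exists `|l - s 0%N|.
near=> n; have := sm' 0%N n (leq0n n); rewrite expr0 divr1; exact.
Unshelve. all: by end_near. Qed.

Lemma sqr_bound_lim (s : nat -> R) (l c A : R) : s @ \oo --> l ->
  (forall n, (s n - c) ^+ 2 <= A * n.+1%:R^-1) -> l = c.
Proof.
move=> sl sA; apply/eqP; rewrite -subr_eq0 -sqrf_eq0 eq_le sqr_ge0 andbT.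
have l2 : (fun n => s n - c) @ \oo --> l - c by exact: (cvgB sl (cvg_cst c)).
have cv : (fun n => (s n - c) ^+ 2) @ \oo --> (l - c) ^+ 2.
  by rewrite expr2; exact: (cvgM l2 l2).
have cv0 : (fun n => A * n.+1%:R^-1) @ \oo --> (0 : R).
  by rewrite -[X in _ --> X](mulr0 A); exact: (cvgM (cvg_cst _) cvg_harmonic).
rewrite -(cvg_lim (@Rhausdorff R) cv) -(cvg_lim (@Rhausdorff R) cv0).
apply: ler_lim.
- by apply/cvg_ex; exists ((l - c) ^+ 2).
- by apply/cvg_ex; exists 0.
- by near=> n; exact: sA.
Unshelve. all: by end_near. Qed.

(** The bound by [|T u|] makes [T u |-> f u] a well-defined bounded functional on a range that need
    not be closed. The images under [T] of a minimizing sequence are Cauchy, and their limit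
    represents it. *)
Lemma riesz_range (E : lmodType R) (D : set E) (T : E -> V) (f : E -> R) (K : R) :
  D 0 -> 0 <= K ->
  (forall r u v, D u -> D v -> D (r *: u + v)) ->
  (forall r u v, D u -> D v -> T (r *: u + v) = r *: T u + T v) ->
  (forall r u v, D u -> D v -> f (r *: u + v) = r * f u + f v) ->
  (forall u, D u -> `|f u| <= K * `|T u|) ->
  exists2 w, closure (T @` D) w & forall u, D u -> dot (T u) w = f u.
Proof.
move=> D0 K0 Dl Tl fl fK.
have TB u v : D u -> D v -> T (u - v) = T u - T v.
  by move=> Du Dv; rewrite addrC -scaleN1r Tl// scaleN1r addrC.
have [|||u Du|x Dx [xC xf]] := @minimizing_sequence R E D
  (fun u v => dot (T u) (T v)) f Dl _ _ _ fl (K ^+ 2) D0 (exprn_ge0 _ K0).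
- by move=> u v _ _; exact: dotC.
- by move=> r u v w Du Dv Dw; rewrite Tl// dotDl dotZl.
- by move=> u Du; exact: dot_ge0.
- by rewrite dotvv -exprMn -ler_sqrt ?exprn_ge0// ?mulr_ge0// !sqrtr_sqr
    (ger0_norm (mulr_ge0 _ _))// fK.
have /cvg_ex[w xw] : cvg ((T \o x) @ \oo).
  by apply: cvg_of_sqr_bound => m n /=; rewrite -TB.
exists w.
  move=> U /xw [k _ kU]; exists (T (x k)); split; last by apply: kU => /=.
  by exists (x k).
move=> u Du; have l1 := cvg_dotr (w := T u) xw.
exact: (sqr_bound_lim l1 (fun n => xf u n Du)).
Qed.

(** The functional [<., h>] restricted to [A] is represented by some [w] in the closure of [A]; then
    [h - w] is orthogonal to [A], so [h = w]. *)
Lemma closure_eqT (A : set V) : A 0 ->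
  (forall r u v, A u -> A v -> A (r *: u + v)) ->
  (forall h, orthocomp A h -> h = 0) -> closure A = [set: V].
Proof.
move=> A0 Al Aperp; rewrite -subTset => h _.
have [|||w] := @riesz_range V A id (dot^~ h) `|h| A0 (normr_ge0 _) Al.
- by [].
- by move=> r u v _ _; rewrite dotDl dotZl.
- by move=> u _; rewrite mulrC dot_le_norm.
rewrite image_id => Aw wh; suff -> : h = w by [].
by apply/eqP; rewrite -subr_eq0; apply/eqP/Aperp => u Au; rewrite dotBr wh// subrr.
Qed.

End HilbertTheory.

(** * Self-adjoint operators, the resolvent and density of the smooth vectors *)

Section OperatorTheory.
Context {R : realType} {V : innerProductType R} (L : operator V).

Lemma op_fun0 : L 0 = 0.
Proof.
have := op_linear (-1) (op_dom0 L) (op_dom0 L).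
by rewrite !scaleN1r !addNr.
Qed.

Lemma op_domB u v : op_dom L u -> op_dom L v -> op_dom L (u - v).
Proof. by move=> Du Dv; rewrite addrC -scaleN1r; exact: op_dom_linear. Qed.

Lemma op_funB u v : op_dom L u -> op_dom L v -> L (u - v) = L u - L v.
Proof. by move=> Du Dv; rewrite addrC -scaleN1r op_linear// scaleN1r addrC. Qed.

End OperatorTheory.

Section SelfAdjoint.
Context {R : realType} {V : hilbertType R} (L : operator V).
Hypothesis L_sa : self_adjoint L.
Local Notation D := (op_dom L).

Lemma self_adjoint_sym x y : D x -> D y -> dot (L x) y = dot x (L y).
Proof.
move=> Dx Dy; have : adjoint (op_graph L) (y, L y) by rewrite L_sa.2.
by apply.
Qed.

Lemma self_adjoint_dom y z :
  (forall x, D x -> dot (L x) y = dot x z) -> D y /\ z = L y.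
Proof.
move=> yz; have : adjoint (op_graph L) (y, z).
  by move=> x _ [/= Dx ->]; exact: yz.
by rewrite L_sa.2.
Qed.

(** An adjoint has a closed graph: the symmetry identity against a fixed vector of the domain passes
    to the limit. *)
Lemma self_adjoint_closed (I : Type) (F : set_system I) {FF : ProperFilter F}
    (g : I -> V) x y :
  (forall i, D (g i)) -> g @ F --> x -> (L \o g) @ F --> y -> D x /\ y = L x.
Proof.
move=> Dg gx gy; apply: self_adjoint_dom => u Du.
have gx' := cvg_dotr (w := L u) gx; have gy' := cvg_dotr (w := u) gy.
apply: (cvg_unique (@Rhausdorff R) gx').
rewrite (_ : (fun i => dot (L u) (g i)) = (fun i => dot u ((L \o g) i)))//.
by apply/funext => i /=; exact: self_adjoint_sym.
Qed.

(* Von Neumann: the orthogonal projection of [(h, 0)] on the closed graph of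
   [L] is [(a, L a)] with [a = (1 + L^2)^-1 h]. *)
Lemma resolvent_ex h : exists a, [/\ D a, D (L a) & a + L (L a) = h].
Proof.
pose q (u v : V) := dot u v + dot (L u) (L v).
have q_ge u : dot u u <= q u u by rewrite lerDl dot_ge0.
have q_geL u : dot (L u) (L u) <= q u u by rewrite lerDr dot_ge0.
have [|||||x Dx [xC xh]] := @minimizing_sequence R V D q (dot^~ h)
  (@op_dom_linear _ _ L) _ _ _ _ (`|h| ^+ 2) (op_dom0 L) (exprn_ge0 _ (normr_ge0 _)).
- by move=> u v _ _; rewrite /q dotC [X in _ + X]dotC.
- by move=> r u v w Du Dv Dw; rewrite /q op_linear// !dotDl !dotZl; ring.
- by move=> u _; rewrite addr_ge0// dot_ge0.
- by move=> r u v _ _; rewrite dotDl dotZl.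
- move=> u _; apply: (@le_trans _ _ (`|h| ^+ 2 * dot u u)); last first.
    by rewrite ler_wpM2l ?exprn_ge0.
  rewrite dotvv -exprMn -real_normK ?num_real// ler_pXn2r ?nnegrE ?mulr_ge0//.
  by rewrite mulrC dot_le_norm.
have /cvg_ex[a xa] : cvg (x @ \oo).
  by apply: cvg_of_sqr_bound => m n; exact: le_trans (q_ge _) (xC m n).
have /cvg_ex[b xb] : cvg ((L \o x) @ \oo).
  apply: cvg_of_sqr_bound => m n /=; rewrite -op_funB//.
  exact: le_trans (q_geL _) (xC m n).
have [Da bE] := self_adjoint_closed Dx xa xb.
have qa u : D u -> dot u a + dot (L u) b = dot u h.
  move=> Du; apply: (@sqr_bound_lim _ (fun n => q u (x n)) _ _ (q u u)) => [|n].
    exact: (cvgD (cvg_dotr (w := u) xa) (cvg_dotr (w := L u) xb)).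
  exact: xh.
(* The limit equation reads [<L u, L a> = <u, h - a>] for all [u] in the domain, which puts [L a] in
   the domain of the adjoint, that is, of [L]. *)
have [|DLa haE] := @self_adjoint_dom (L a) (h - a).
  by move=> u Du; rewrite dotBr -(qa _ Du) bE addrAC subrr add0r.
by exists a; rewrite -haE addrC subrK.
Qed.

Definition resolvent h : V := projT1 (cid (resolvent_ex h)).
Local Notation B := resolvent.

Lemma resolventP h : [/\ D (B h), D (L (B h)) & B h + L (L (B h)) = h].
Proof. exact: projT2 (cid (resolvent_ex h)). Qed.

Lemma resolvent_dom h : D (B h). Proof. by have [] := resolventP h. Qed.
Lemma resolvent_domL h : D (L (B h)). Proof. by have [] := resolventP h. Qed.
Lemma resolventK h : B h + L (L (B h)) = h. Proof. by have [] := resolventP h. Qed.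

(** The right-hand side is symmetric in [h] and [k], whence the symmetry of [B]; for [h = k] it
    dominates [|B h|^2], whence [B] is a contraction. *)
Lemma dot_resolvent h k : dot h (B k) = dot (B h) (B k) + dot (L (B h)) (L (B k)).
Proof.
rewrite -{1}(resolventK h) dotDl self_adjoint_sym//.
  exact: resolvent_domL.
exact: resolvent_dom.
Qed.

Lemma resolvent_sym h k : dot (B h) k = dot h (B k).
Proof. by rewrite dot_resolvent dotC dot_resolvent dotC [X in _ + X]dotC. Qed.

(** [1 + L^2] is injective, since [<d, d + L (L d)> = |d|^2 + |L d|^2]. *)
Lemma resolvent_unique a : D a -> D (L a) -> B (a + L (L a)) = a.
Proof.
move=> Da DLa; set h := a + _.
have Dd : D (B h - a) by apply: op_domB => //; exact: resolvent_dom.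
have DLd : D (L (B h - a)).
  rewrite op_funB//; last exact: resolvent_dom.
  by apply: op_domB => //; exact: resolvent_domL.
have dE : (B h - a) + L (L (B h - a)) = 0.
  rewrite !op_funB//; [|exact: resolvent_domL|exact: resolvent_dom].
  by rewrite addrACA resolventK -opprD subrr.
apply/eqP; rewrite -subr_eq0; apply/eqP/dotvv_eq0.
have := dot0r (B h - a); rewrite -dE dotDr -self_adjoint_sym// => /eqP.
by rewrite paddr_eq0 ?dot_ge0// => /andP[/eqP].
Qed.

Lemma resolvent_linear r u v : B (r *: u + v) = r *: B u + B v.
Proof.
have Dl := op_dom_linear r (resolvent_dom u) (resolvent_dom v).
have lE : L (r *: B u + B v) = r *: L (B u) + L (B v).
  by rewrite op_linear//; exact: resolvent_dom.
have DLl : D (L (r *: B u + B v)).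
  by rewrite lE; apply: op_dom_linear; exact: resolvent_domL.
rewrite -(resolvent_unique Dl DLl); congr B.
rewrite lE op_linear; [|exact: resolvent_domL|exact: resolvent_domL].
by rewrite addrACA -scalerDr !resolventK.
Qed.

Lemma resolventB u v : B (u - v) = B u - B v.
Proof. by rewrite addrC -scaleN1r resolvent_linear scaleN1r addrC. Qed.

Lemma resolvent_norm h : `|B h| <= `|h|.
Proof.
have [->|B0] := eqVneq (B h) 0; first by rewrite normr0.
rewrite -(@ler_pM2r _ `|B h|) ?normr_gt0//.
rewrite -expr2 -dotvv (le_trans _ (le_trans (ler_norm _) (dot_le_norm h (B h))))//.
by rewrite (dot_resolvent h) lerDl dot_ge0.
Qed.

(** [L (L (B z)) = z - B z] is again in the domain, so applying [L] to [B z + L (L (B z)) = z] shows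
    that [L (B z)] solves the equation defining [B (L z)]. *)
Lemma resolvent_comm z : D z -> L (B z) = B (L z).
Proof.
move=> Dz; have LLB : L (L (B z)) = z - B z.
  by rewrite -{2}(resolventK z) addrC addKr.
have DLLB : D (L (L (B z))) by rewrite LLB; exact: op_domB Dz (resolvent_dom z).
rewrite -(resolvent_unique (resolvent_domL z) DLLB) LLB op_funB//.
  by rewrite [_ + (_ - _)]addrC subrK.
exact: resolvent_dom.
Qed.

Lemma resolvent_inj0 h : B h = 0 -> h = 0.
Proof. by move=> h0; rewrite -(resolventK h) h0 !op_fun0 addr0. Qed.

Lemma resolvent_approx h (e : R) : 0 < e -> exists y, `|B y - h| < e.
Proof.
move=> e0; have : closure (range B) h.
  rewrite closure_eqT//.
  - by exists 0 => //; have := resolventB 0 0; rewrite !subrr.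
  - move=> r _ _ [u _ <-] [v _ <-]; exists (r *: u + v) => //.
    exact: resolvent_linear.
  (* If [k] is orthogonal to the range, then [|B k|^2 = <k, B (B k)> = 0]. *)
  - move=> k kB; apply: resolvent_inj0; apply: dotvv_eq0.
    by rewrite resolvent_sym dotC; apply: kB; exists (B k).
move=> /(_ (ball h e) (nbhsx_ballx _ _ e0))[_ [[y _ <-]]].
by rewrite -ball_normE /= distrC; exists y.
Qed.

(* Mittag-Leffler: each [y n.+1] is chosen so that [B (y n.+1)] is close to
   [y n]; the limits of [B^n (y (k + n))] form an infinite chain of preimages. *)
Lemma resolvent_chain h (e : R) : 0 < e -> exists2 z : nat -> V,
  (forall k, z k = B (z k.+1)) & `|z 0%N - h| <= e.
Proof.
(* The tolerances start at [e / 2] so that their geometric sum is [e]. *)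
move=> e0; have c0 n : 0 < e / 2 / 2 ^+ n :> R by rewrite !divr_gt0// exprn_gt0.
have /choice[step stepP] (ny : nat * V) :
    exists y', `|B y' - ny.2| < e / 2 / 2 ^+ ny.1.
  exact: resolvent_approx.
pose y := fix y n := if n is m.+1 then step (m, y m) else h.
have yP n : `|B (y n.+1) - y n| < e / 2 / 2 ^+ n by exact: stepP (n, y n).
pose s k n := iter n B (y (k + n)%N).
have iterB n u v : iter n B u - iter n B v = iter n B (u - v).
  by elim: n => //= n IH; rewrite -resolventB IH.
have iter_norm n u : `|iter n B u| <= `|u|.
  by elim: n => //= n IH; exact: le_trans (resolvent_norm _) IH.
have sP k n : `|s k n.+1 - s k n| <= e / 2 / 2 ^+ k / 2 ^+ n.
  rewrite /s addnS iterSr iterB (le_trans (iter_norm _ _))//.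
  by rewrite (le_trans (ltW (yP _)))// exprD invfM mulrA.
have /choice[z zP] k : exists z,
    s k @ \oo --> z /\ `|z - s k 0%N| <= 2 * (e / 2 / 2 ^+ k).
  by have [l] := geometric_seq_cvg (ltW (c0 k)) (sP k); exists l.
exists z => [k|]; last first.
  have [_] := zP 0%N; rewrite /s addn0 /= expr0 divr1 mulrCA mulfV ?mulr1//.
have Bc : B (s k.+1 n) @[n --> \oo] --> B (z k.+1).
  apply/cvgrPdist_le => d d0; have [/cvgrPdist_le/(_ d d0) + _] := zP k.+1.
  apply: filterS => n; rewrite -resolventB; exact: le_trans (resolvent_norm _).
have sc : s k n.+1 @[n --> \oo] --> z k.
  by have [sz _] := zP k; rewrite (cvg_shiftS (s k)).
apply: (cvg_unique (@norm_hausdorff _ V) sc).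
rewrite (_ : (fun n => s k n.+1) = (fun n => B (s k.+1 n)))//.
by apply/funext => n; rewrite /s /= addnS.
Qed.

(** [L] commutes with [B] on its domain, so it maps chains of preimages to chains; the head of any
    chain is in the range of [B], hence in the domain. *)
Lemma smooth_of_chain (z : nat -> V) :
  (forall k, z k = B (z k.+1)) -> z 0%N \in smooth_pred L.
Proof.
move=> zB; apply/smooth_predP => i.
suff [y yB ->] : exists2 y : nat -> V,
    forall k, y k = B (y k.+1) & iter i L (z 0%N) = y 0%N.
  by rewrite yB; exact: resolvent_dom.
elim: i => [|i [y yB IH]]; first by exists z.
exists (L \o y) => [k|] /=; last by rewrite IH.
by rewrite -resolvent_comm -?yB// [y k.+1]yB; exact: resolvent_dom.
Qed.

Lemma smooth_approx h (e : R) : 0 < e ->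
  exists u : smooth L, `|smooth_incl L u - h| <= e.
Proof.
move=> /(resolvent_chain h)[z zB zh].
by exists (Smooth (smooth_of_chain zB)).
Qed.

Lemma smooth_dense : dense (range (smooth_incl L)).
Proof.
move=> O [h Oh] oO.
have /nbhs_ballP[e /= e0 eO] : nbhs h O by apply: open_nbhs_nbhs.
have [u uh] := smooth_approx h (divr_gt0 e0 (ltr0Sn _ 1)).
exists (smooth_incl L u); split; last by exists u.
apply: eO; rewrite -ball_normE /= distrC (le_lt_trans uh)// ltr_pdivrMr//.
by rewrite ltr_pMr// ltr1n.
Qed.

(** By density, the norm of [v] can be computed by testing against smooth vectors only. *)
Lemma smooth_norm_le v (c : R) : 0 <= c ->
  (forall u : smooth L, `|dot (smooth_incl L u) v| <= c * `|smooth_incl L u|) ->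
  `|v| <= c.
Proof.
move=> c0 uc; rewrite leNgt; apply/negP => cv.
have v0 : 0 < `|v| := le_lt_trans c0 cv.
have vc0 : 0 < `|v| + c by rewrite ltr_pwDl.
(* Approximating [v] within [e] yields [|v| * (|v| - c) <= e * (|v| + c)]; this [e] makes the
   right-hand side half of the left-hand side, which is positive. *)
pose e := `|v| * (`|v| - c) / 2 / (`|v| + c).
have e0 : 0 < e by rewrite !divr_gt0// mulr_gt0// subr_gt0.
have [u uv] := smooth_approx v e0; set i := smooth_incl L u in uv.
have iv : `|i| <= `|v| + e.
  by rewrite -(subrK v i) addrC (le_trans (ler_normD _ _))// lerD2l.
have : `|v| ^+ 2 <= e * `|v| + c * (`|v| + e).
  rewrite -dotvv -[X in dot X v](subrK i) dotDl (le_trans (ler_norm _))//.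
  rewrite (le_trans (ler_normD _ _))// lerD//.
    by rewrite (le_trans (dot_le_norm _ _))// distrC ler_wpM2r.
  by rewrite (le_trans (uc u))// ler_wpM2l.
have eE : e * (`|v| + c) = `|v| * (`|v| - c) / 2 by rewrite /e mulfVK// gt_eqF.
have : 0 < `|v| * (`|v| - c) by rewrite mulr_gt0// subr_gt0.
rewrite expr2; move: eE; set x := `|v|; lra.
Qed.

Lemma smooth_orthocomp v :
  (forall u : smooth L, dot (smooth_incl L u) v = 0) -> v = 0.
Proof.
move=> uv; apply/eqP; rewrite -normr_le0; apply: smooth_norm_le => // u.
by rewrite uv normr0 mul0r.
Qed.

End SelfAdjoint.

Section ClosedOrthocomplement.
Context {R : realType} {V : innerProductType R}.

Lemma orthocomp_closure (A : set V) : orthocomp A `<=` orthocomp (closure A).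
Proof.
move=> h Ah x Ax; have : closed [set x | dotr h x = 0].
  apply: (@preimage_closed _ _ (dotr h) [set (0 : R^o)]).
    by move=> y _; exact: dotr_continuous.
  exact: closed_eq.
move=> /closure_id hE; rewrite -[dot x h = 0]/([set x | dotr h x = 0] x) hE.
by apply: closure_subset Ax.
Qed.

End ClosedOrthocomplement.

(** * The topology of the space of smooth vectors *)

Section SmoothTopology.
Context {R : realType} {V : innerProductType R} (L : operator V).

Lemma op_power_continuous p : continuous (op_power (L := L) p).
Proof.
move=> u; apply/(@cvgrPdist_lt _ _ _ (nbhs u)) => e e0.
exists p, e => // w /(_ p (leqnn p)); by rewrite linearB distrC.
Qed.

Lemma smooth_incl_continuous : continuous (smooth_incl L).
Proof. by move=> u; have := @op_power_continuous 0 u. Qed.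

Lemma smooth_hausdorff : hausdorff_space (smooth L).
Proof.
move=> u v uv; apply: val_inj; apply: (@norm_hausdorff _ V) => P Q Pu Qv.
have [w [Pw Qw]] := uv _ _ (smooth_incl_continuous Pu) (smooth_incl_continuous Qv).
by exists (smooth_incl L w).
Qed.

Lemma seminorm_ball_entourage n (e : R) : 0 < e ->
  entourage [set uv : smooth L * smooth L | seminorm_ball 0 n e (uv.1 - uv.2)].
Proof.
move=> e0; exists (seminorm_ball 0 n e); split; first exact: seminorm_ball_nbhs.
by move=> uv; rewrite !inE.
Qed.

Lemma smooth_countable_uniformity : countable_uniformity (smooth L).
Proof.
apply/countable_uniformityP.
exists (fun n => [set uv | seminorm_ball 0 n n.+1%:R^-1 (uv.1 - uv.2)]).
  move=> A [U [[n [e e0 neU]] UA]].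
  have [k _ kP] := near_infty_natSinv_lt (PosNum e0).
  exists (maxn n k) => uv uvP; apply/set_mem/UA/mem_set/neU => p pn.
  apply: lt_trans (uvP p _) (kP _ _); last exact: leq_maxr.
  exact: leq_trans pn (leq_maxl _ _).
by move=> n; apply: seminorm_ball_entourage; rewrite invr_gt0.
Qed.

(** The topology is the initial one for the maps [op_power p]. A basic neighbourhood constrains only
    finitely many of them, so an induction on their number suffices. *)
Lemma smooth_cvg (F : set_system (smooth L)) (u : smooth L) : Filter F ->
  (forall p, op_power p @ F --> op_power p u) -> F --> u.
Proof.
move=> FF Fu U [n [e e0 neU]]; apply: (filterS neU).
suff : forall m, F [set w | forall p, (p <= m)%N -> `|op_power p (w - u)| < e].
  exact.
have Fp p : F [set w | `|op_power p (w - u)| < e].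
  have /cvgrPdist_lt/(_ e e0) := Fu p; apply: filterS => w /=.
  by rewrite linearB distrC.
elim=> [|m IH].
  by apply: filterS (Fp 0%N) => w wu p; rewrite leqn0 => /eqP ->.
apply: filterS2 IH (Fp m.+1) => w wm wS p.
by rewrite leq_eqVlt => /predU1P[->//|]; exact: wm.
Qed.

Lemma op_power_cauchy (F : set_system (smooth L)) {FF : Filter F} p : cauchy F ->
  cauchy (op_power p @ F).
Proof.
move=> cF; apply/cauchy_ballP => e e0.
have [[P Q] /= [FP FQ] PQ] := cF _ (seminorm_ball_entourage p e0).
exists (op_power p @` P, op_power p @` Q).
  by split; [apply: filterS FP|apply: filterS FQ] => u Pu; exists u.
move=> [_ _] [/= [u Pu <-] [w Qw <-]]; rewrite -ball_normE /=.
by have := PQ (u, w) (conj Pu Qw) p (leqnn p); rewrite /= subr0 linearB.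
Qed.

Lemma smooth_dom (u : smooth L) : op_dom L (smooth_incl L u).
Proof. exact: ((smooth_predP L _).1 (smoothP u) 0%N). Qed.

End SmoothTopology.

(** * Negative powers applied to functionals *)

Section NegativePower.
Context {R : realType} {V : hilbertType R} (L : operator V).

(** The representative from [riesz_range] lies in the closure of the range of [L^p], so [<., w>] is
    automatically the extension by [0] on the orthogonal complement. *)
Lemma neg_power_ex p (f : {linear smooth L -> R^o}) (K : R) : 0 <= K ->
  (forall u, `|f u| <= K * `|op_power p u|) -> exists w, is_neg_power p f w.
Proof.
move=> K0 fK.
have [|||||w wcl wf] := @riesz_range R V (smooth L) setT (op_power p) f K _ K0 => //.
- by move=> r u v _ _; rewrite linearP.
- by move=> r u v _ _; rewrite linearP.
exists w, (dotr w); split => //.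
- exact: dotr_continuous.
- by move=> s; exact: wf.
- by move=> h hA; rewrite -[LHS]/(dot h w) dotC; exact: hA.
Qed.

Lemma neg_powerE p (f : {linear smooth L -> R^o}) w : is_neg_power p f w ->
  forall u, f u = dot (op_power p u) w.
Proof. by move=> [phi [_ phif _ phiw]] u; rewrite -phif phiw. Qed.

(** [w - w'] is orthogonal to the closed range, where both extensions vanish; evaluating them at
    [w - w'] gives [|w - w'|^2 = 0]. *)
Lemma neg_power_unique p (f : {linear smooth L -> R^o}) w w' :
  is_neg_power p f w -> is_neg_power p f w' -> w = w'.
Proof.
move=> nw nw'; have fw := neg_powerE nw; have fw' := neg_powerE nw'.
have perp : orthocomp (closure (range (@op_power _ _ L p))) (w - w').
  by apply: orthocomp_closure => _ [u _ <-]; rewrite dotBr -fw -fw' subrr.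
case: nw nw' => [phi [_ _ phi0 phiw]] [psi [_ _ psi0 psiw]].
apply/eqP; rewrite -subr_eq0; apply/eqP/dotvv_eq0.
by rewrite [LHS]dotBr -phiw -psiw phi0// psi0// subrr.
Qed.

End NegativePower.

(** * The Gel'fand triple of an unbounded self-adjoint operator *)

Section Unbounded.
Context {R : realType} {V : hilbertType R} (L : operator V).
Hypothesis L_sa : self_adjoint L.
Hypothesis L_unbounded : ~ bounded_graph (op_graph L).

(* Hellinger-Toeplitz *)
Lemma op_dom_neqT : op_dom L <> [set: V].
Proof.
move=> DT; have D x : op_dom L x by rewrite DT.
(* Here [g 0 = 0], as [0^-1 = 0]. By symmetry of [L], the functionals [<., g x>] are bounded at each
   [y] by [|L y|], uniformly in [x]. *)
pose g x := `|x|^-1 *: L x.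
pose F := [set f : V -> R^o | exists x, f = dotr (g x)].
have [||M MP] := @Banach_Steinhauss R V R^o F _ _ 1.
- move=> _ [x ->]; split; last exact: linearP.
  move=> r; exists (r * `|g x|) => y yr.
  by rewrite (le_trans (dot_le_norm _ _))// ler_wpM2r.
- move=> y; exists `|L y| => _ [x ->]; rewrite /dotr /g dotZr.
  rewrite -(self_adjoint_sym L_sa)// normrM normfV normr_id; have [->|x0] := eqVneq x 0.
    by rewrite normr0 invr0 mul0r.
  rewrite mulrC ler_pdivrMr ?normr_gt0//; exact: dot_le_norm.
apply: L_unbounded; exists M => x _ [/= _ ->].
have [->|x0] := eqVneq x 0; first by rewrite op_fun0 !normr0 mulr0.
have [->|Lx0] := eqVneq (L x) 0.
  rewrite normr0 mulr_ge0//; apply: le_trans (MP (dotr (g x)) _ 0 _) => //.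
    by exists x.
  by rewrite normr0.
(* On the unit vector along [L x], the uniform bound becomes [|L x| <= M * |x|]. *)
have := MP (dotr (g x)) (ex_intro _ x erefl) (`|L x|^-1 *: L x).
rewrite normrZ normfV normr_id mulVf ?normr_eq0// => /(_ (lexx _)).
rewrite /dotr /g dotZl dotZr dotvv !normrM !normfV !normr_id.
rewrite -ler_pdivrMr ?normr_gt0//.
apply: le_trans; rewrite le_eqVlt; apply/orP; left; apply/eqP; field.
by rewrite !normr_eq0 x0.
Qed.

(** Along a Cauchy filter each [L^p] has a limit [z p]; closedness of the graph gives
    [z p.+1 = L (z p)], so [z 0] is smooth and is the limit. *)
Lemma smooth_complete (F : set_system (smooth L)) : ProperFilter F -> cauchy F ->
  exists u : smooth L, F --> u.
Proof.
move=> FF cF.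
have /choice[z zP] : forall p, exists z : V, op_power p @ F --> z.
  move=> p; have FpF : ProperFilter (op_power p @ F) by exact: fmap_proper_filter.
  have /cvg_ex[z] : cvg (op_power p @ F).
    by apply: cauchy_cvg; exact: op_power_cauchy.
  by exists z.
have opD p (u : smooth L) : op_dom L (op_power p u).
  exact: ((smooth_predP L _).1 (smoothP u)).
have zS p : op_dom L (z p) /\ z p.+1 = L (z p).
  exact: (self_adjoint_closed L_sa (opD p) (zP p) (zP p.+1)).
have zE i : iter i L (z 0%N) = z i by elim: i => //= i ->; rewrite (zS i).2.
have z0 : z 0%N \in smooth_pred L.
  by apply/smooth_predP => i; rewrite zE; have [] := zS i.
exists (Smooth z0); apply: smooth_cvg => p.
by rewrite {2}/op_power /smooth_incl /= zE.
Qed.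

Lemma resolvent_smooth (h : smooth L) :
  resolvent L_sa (smooth_incl L h) \in smooth_pred L.
Proof.
have hD i : op_dom L (iter i L (smooth_incl L h)).
  exact: ((smooth_predP L _).1 (smoothP h)).
apply/smooth_predP => i.
suff -> : iter i L (resolvent L_sa (smooth_incl L h)) =
    resolvent L_sa (iter i L (smooth_incl L h)) by exact: resolvent_dom.
by elim: i => //= i ->; rewrite resolvent_comm.
Qed.

Lemma smooth_gelfand_triple : gelfand_triple (smooth L) (smooth_incl L).
Proof.
split.
- by split; [exact: val_inj|exact: smooth_dense].
- split; [exact: smooth_hausdorff|exact: smooth_countable_uniformity|].
  exact: smooth_complete.
- split; last exact: smooth_incl_continuous.
  split.
    by move=> W oW; apply: open_comp => // x _; exact: smooth_incl_continuous.
  (* If this set came from an open [W] of [V], a ball of radius [e] in [W] would give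
     [|L u| <= 2 / e * |u|] for smooth [u], by scaling [u] to norm [e / 2]. *)
  exists [set u | `|op_power 1 u| < 1].
    rewrite (_ : [set u | _] = (fun u => `|op_power 1 u|) @^-1` [set x | x < 1])//.
    apply: open_comp; last exact: open_lt.
    move=> u _; apply: continuous_comp; first exact: op_power_continuous.
    exact: norm_continuous.
  move=> W oW WE; apply: L_unbounded.
  have W0 : W 0.
    have : [set u : smooth L | `|op_power 1 u| < 1] 0.
      by rewrite /= /op_power /smooth_incl /= op_fun0 normr0.
    by rewrite -WE.
  have lt1 (u : smooth L) : W (smooth_incl L u) -> `|op_power 1 u| < 1.
    by move=> Wu; have : (smooth_incl L @^-1` W) u by []; rewrite WE.
  have /nbhs_ballP[e /= e0 eW] : nbhs (0 : V) W by apply: open_nbhs_nbhs.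
  have Lu (u : smooth L) : `|op_power 1 u| <= 2 / e * `|smooth_incl L u|.
    have [u0|u0] := eqVneq (smooth_incl L u) 0.
      by rewrite /op_power /= u0 op_fun0 normr0 mulr0.
    pose c := e / 2 / `|smooth_incl L u|.
    have c0 : 0 < c by rewrite !divr_gt0// normr_gt0.
    have : `|op_power 1 (c *: u)| < 1.
      apply: lt1; apply: eW; rewrite -ball_normE /= sub0r normrN linearZ normrZ.
      rewrite gtr0_norm// /c mulfVK ?normr_eq0// ltr_pdivrMr//.
      by rewrite ltr_pMr// ltr1n.
    rewrite linearZ normrZ gtr0_norm// mulrC -ltr_pdivlMr// => /ltW/le_trans; apply.
    by rewrite le_eqVlt; apply/orP; left; apply/eqP; rewrite /c; field;
      rewrite normr_eq0 u0 gt_eqF.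
  exists (2 / e) => x _ [/= Dx ->].
  (* The bound passes from the smooth vectors to the whole domain by duality, through
     [<u, L x> = <L u, x>]. *)
  apply: (smooth_norm_le L_sa) => [|u]; first by rewrite mulr_ge0// divr_ge0// ltW.
  rewrite -(self_adjoint_sym L_sa)//; last exact: smooth_dom.
  rewrite (le_trans (dot_le_norm _ _))// mulrAC ler_wpM2r//; exact: Lu.
- move=> rT; apply: op_dom_neqT; rewrite -subTset -rT => _ [u _ <-].
  exact: smooth_dom.
- split.
  + move=> v u; exact: (continuous_comp (@smooth_incl_continuous _ _ L u)
      (@dotr_continuous _ _ v _)).
  + move=> v w vw; apply/eqP; rewrite -subr_eq0.
    apply/eqP/(smooth_orthocomp L_sa) => u.
    by rewrite dotBr; apply/eqP; rewrite subr_eq0; apply/eqP; exact: vw.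
  + have [y yB] : exists y, ~ range (resolvent L_sa) y.
      apply/existsNP => rT; apply: op_dom_neqT; rewrite -subTset => y _.
      by have [h _ <-] := rT y; exact: resolvent_dom.
    exists (dotr y \o (op_power (L := L) 2 \+ smooth_incl L)).
      move=> u.
      apply: (@continuous_comp _ _ _ (op_power (L := L) 2 \+ smooth_incl L)).
        exact: (cvgD (@op_power_continuous _ _ L 2 u)
                     (@smooth_incl_continuous _ _ L u)).
      exact: dotr_continuous.
    move=> w fw; apply: yB; exists w => //.
    apply/eqP; rewrite -subr_eq0; apply/eqP/(smooth_orthocomp L_sa) => h.
    (* At [B h], with [B] the resolvent, the functional takes the value [<h, y>]. A representative
       [w] gives [<B h, w> = <h, B w>] instead, so [y = B w]. *)
    have := fw (Smooth (resolvent_smooth h)).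
    rewrite /riesz /= /dotr /op_power /smooth_incl /= addrC resolventK.
    by rewrite resolvent_sym => yw; rewrite dotBr yw subrr.
Qed.

End Unbounded.

(** * Diagonal operators in an orthonormal basis *)

Section DiagonalOperator.
Context {R : realType} {V : hilbertType R} (e : nat -> V).
Hypothesis e_orthonormal : forall i j, dot (e i) (e j) = (i == j)%:R.
Hypothesis e_total : forall h, (forall i, dot h (e i) = 0) -> h = 0.

Definition partial_sum n (y : V) : V := \sum_(i < n) dot y (e i) *: e i.

Lemma partial_sum_linear n r u v :
  partial_sum n (r *: u + v) = r *: partial_sum n u + partial_sum n v.
Proof.
rewrite /partial_sum scaler_sumr -big_split /=; apply: eq_bigr => i _.
by rewrite dotDl dotZl scalerDl scalerA.
Qed.

Lemma dot_partial_sum n y z :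
  dot (partial_sum n y) z = \sum_(i < n) dot y (e i) * dot z (e i).
Proof.
by rewrite dot_suml; apply: eq_bigr => i _; rewrite dotZl (dotC z).
Qed.

Lemma dot_sum_orthonormal n (a : 'I_n -> R) (i : 'I_n) :
  dot (\sum_(j < n) a j *: e j) (e i) = a i.
Proof.
rewrite dot_suml (bigD1 i)//= big1 ?addr0.
  by rewrite dotZl e_orthonormal eqxx mulr1.
by move=> j; rewrite -val_eqE /= => /negbTE ji; rewrite dotZl e_orthonormal ji mulr0.
Qed.

Lemma partial_sum_dist n y : `|y - partial_sum n y| <= `|y|.
Proof.
apply: norm_le_sqr => //; rewrite -dotvv dotBl !dotBr (dotC y).
have -> : dot (partial_sum n y) (partial_sum n y) = dot (partial_sum n y) y.
  rewrite !dot_partial_sum; apply: eq_bigr => i _.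
  by rewrite (@dot_sum_orthonormal n (fun i => dot y (e i)) i).
rewrite subrr subr0 gerBl dot_partial_sum sumr_ge0// => i _.
by rewrite -expr2 sqr_ge0.
Qed.

(** Vectors fixed by all late partial sums form a subspace containing the basis, hence dense;
    [partial_sum_dist] carries the convergence over to its closure. *)
Lemma partial_sum_cvg y : partial_sum n y @[n --> \oo] --> y.
Proof.
pose A := [set s : V | exists k, forall n, (k <= n)%N -> partial_sum n s = s].
have /seteqP[_ /(_ y I) clA] : closure A = [set: V].
  apply: closure_eqT.
  - exists 0%N => n _; rewrite /partial_sum big1// => i _.
    by rewrite dot0l scale0r.
  - move=> r u v [k ku] [m mv]; exists (maxn k m) => n; rewrite geq_max.
    by move=> /andP[kn mn]; rewrite partial_sum_linear ku// mv.
  - move=> h hA; apply: e_total => i; rewrite dotC; apply: hA; exists i.+1 => n ni.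
    rewrite /partial_sum (bigD1 (Ordinal ni))//= e_orthonormal eqxx scale1r.
    rewrite big1 ?addr0// => j; rewrite -val_eqE /= => /negbTE ji.
    by rewrite e_orthonormal eq_sym ji scale0r.
apply/cvgrPdist_lt => d d0.
have [s [[k ks]]] := clA _ (nbhsx_ballx y _ d0).
rewrite -ball_normE /= => ysd; exists k => // n /= kn.
apply: le_lt_trans ysd; have := partial_sum_dist n (y - s).
rewrite [y - s]addrC -scaleN1r partial_sum_linear ks// scaleN1r.
by rewrite opprD opprK addrACA addNr add0r.
Qed.

(** Each coefficient relation is a closed condition that holds on the diagonal graph. Conversely,
    truncating [y] and [z] at a common index gives points of that graph converging to [(y, z)]. *)
Lemma closure_diagonalP y z : closure (diagonal_graph e) (y, z) <->
  forall i, i.+1%:R * dot y (e i) = dot z (e i).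
Proof.
split=> [yz i|yz].
  pose g (p : V * V) : R^o := i.+1%:R * dot p.1 (e i) - dot p.2 (e i).
  have gc : continuous g.
    move=> p; apply: cvgB; last by apply: cvg_dotl; exact: cvg_snd.
    by apply: cvgM; [exact: cvg_cst|apply: cvg_dotl; exact: cvg_fst].
  have : closed (g @^-1` [set (0 : R^o)]).
    by apply: preimage_closed; [move=> p _; exact: gc|exact: closed_eq].
  move=> /closure_id gE.
  suff : (g @^-1` [set (0 : R^o)]) (y, z).
    by rewrite /= /g /= => /eqP; rewrite subr_eq0 => /eqP.
  rewrite gE; apply: closure_subset yz => _ [n [a ->]]; rewrite /g /=.
  rewrite !dot_suml mulr_sumr -sumrB big1// => j _.
  rewrite !dotZl e_orthonormal; case: eqVneq => [->|_] /=; ring.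
move=> U [[A B] /= [Ay Bz] ABU].
have [k _ kA] := partial_sum_cvg Ay; have [m _ mB] := partial_sum_cvg Bz.
exists (partial_sum (maxn k m) y, partial_sum (maxn k m) z); split.
  exists (maxn k m), (fun i => dot y (e i)); congr (_, _).
  by apply: eq_bigr => i _; rewrite yz.
by apply: ABU; split; [apply: kA|apply: mB] => /=; rewrite ?leq_maxl ?leq_maxr.
Qed.

Variable L : operator V.
Hypothesis L_graph : op_graph L = closure (diagonal_graph e).

Lemma diagonal_opP y z :
  op_graph L (y, z) <-> forall i, i.+1%:R * dot y (e i) = dot z (e i).
Proof. by rewrite L_graph; exact: closure_diagonalP. Qed.

Lemma diagonal_op_basis n : op_graph L (e n, n.+1%:R *: e n).
Proof.
apply/diagonal_opP => i; rewrite dotZl e_orthonormal.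
by case: eqVneq => [->//|_]; rewrite !mulr0.
Qed.

(** An adjoint pair tested on the basis satisfies the coefficient relations. Conversely, these make
    the two sides of the adjoint identity agree on partial sums, hence in the limit. *)
Lemma diagonal_op_self_adjoint : self_adjoint L.
Proof.
split.
  move=> O [h Oh] oO.
  have [k _ kO] := partial_sum_cvg (open_nbhs_nbhs (conj oO Oh)).
  exists (partial_sum k h); split; first by apply: kO => /=.
  rewrite /partial_sum; elim/big_ind: _ => [|u v Du Dv|i _].
  - exact: op_dom0.
  - by rewrite -[u]scale1r; exact: op_dom_linear.
  - rewrite -[X in op_dom L X]addr0; apply: op_dom_linear (op_dom0 L).
    by case: (diagonal_op_basis i).
apply/seteqP; split=> [[y z] adj|[y z] /diagonal_opP yz x w /diagonal_opP xw].
  apply/diagonal_opP => i; have /= := adj _ _ (diagonal_op_basis i).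
  by rewrite dotZl !(dotC (e i)).
have wy := cvg_dotl (w := w) (partial_sum_cvg (y := y)).
have xz := cvg_dotl (w := x) (partial_sum_cvg (y := z)).
rewrite /= dotC (dotC x); apply: (cvg_unique (@Rhausdorff R) wy).
rewrite (_ : (fun n => _) = (fun n => dot (partial_sum n z) x))//.
apply/funext => n; rewrite !dot_partial_sum; apply: eq_bigr => i _.
by rewrite -yz -xw; ring.
Qed.

Lemma diagonal_op_unbounded : ~ bounded_graph (op_graph L).
Proof.
move=> [C CP]; have ne n : `|e n| = 1.
  by rewrite normr_dot e_orthonormal eqxx sqrtr1.
have := CP _ _ (diagonal_op_basis (Num.bound `|C|)).
rewrite normrZ !ne !mulr1 normr_nat => CN.
have := le_lt_trans CN (le_lt_trans (ler_norm C) (archi_boundP (normr_ge0 C))).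
by rewrite ltr_nat ltnNge leqnSn.
Qed.

End DiagonalOperator.

(** * Unordered sums and completeness of the energy space *)

Section SumBounds.
Context {R : realType} {T : choiceType} (f : T -> R).
Lemma esum_le_fin (M : R) : (forall r, uniq r -> \sum_(i <- r) f i <= M) ->
  (\esum_(i in [set: T]) (f i)%:E <= M%:E)%E.
Proof.
move=> fM; apply: ge_ereal_sup => _ [A [finA _] <-].
by rewrite fsbig_finite//= sumEFin lee_fin; apply: fM; exact: finmap.fset_uniq.
Qed.

Lemma sum_le_rsum r : (forall i, 0 <= f i) -> abs_summable f -> uniq r ->
  \sum_(i <- r) f i <= rsum f.
Proof.
move=> f_ge0 sf ur; rewrite rsum_ge0E// -lee_fin fineK.
  apply: esum_ge; exists [set` r]; first by split => //; exact: finite_seq.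
  by rewrite -fsbig_seq// sumEFin.
rewrite ge0_fin_numE; last by apply: esum_ge0 => i; rewrite lee_fin.
by apply: le_lt_trans sf; apply: le_esum => i _ /=; rewrite lee_fin ler_norm.
Qed.

End SumBounds.

Section EnergySpaceTheory.
Context {R : realType} {G : choiceType} (N : network R G).
Implicit Types (U W : HE N) (u v : finE N) (x y : G).

Lemma finE_finite_energy u : finite_energy N u.
Proof. by have /asboolP := finEP u. Qed.

Lemma dot_class u v : dot (class_of u) (class_of v) = energy N u v.
Proof. exact: HEdot_class. Qed.

Lemma potential_drop_class u x y : potential_drop (class_of u) x y = u x - u y.
Proof.
by have [a ua] := rep_class u; rewrite /potential_drop !ua opprD addrACA subrr addr0.
Qed.

Lemma potential_dropB U W x y :
  potential_drop (U - W) x y = potential_drop U x y - potential_drop W x y.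
Proof.
rewrite -[U in LHS]repK -[W in LHS]repK -class_ofB potential_drop_class /=.
by rewrite /potential_drop !fctE /=; ring.
Qed.

Lemma HE_eq0 U o : (forall x, potential_drop U x o = 0) -> U = 0.
Proof.
move=> U0; rewrite -[U]repK -(class_of0 N); apply/class_ofP; exists (rep U o).
apply/funext => x; rewrite /= subr0; apply/eqP; rewrite -subr_eq0; apply/eqP.
exact: U0.
Qed.

Lemma energy_term_le U r : uniq r ->
  \sum_(xy <- r) N xy.1 xy.2 * potential_drop U xy.1 xy.2 ^+ 2 <= 2 * `|U| ^+ 2.
Proof.
move=> ur; rewrite -dotvv -[X in dot X _]repK -[X in dot _ X]repK dot_class /energy.
rewrite mulrA divff ?mul1r ?pnatr_eq0//.
apply: le_trans (sum_le_rsum (@energy_term_ge0 _ _ N (rep U)) _ ur).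
  by apply: ler_sum => xy _; rewrite /energy_term expr2 mulrA.
exact: ((finite_energyE N (rep U)).1 (finE_finite_energy (rep U))).
Qed.

(** A single term of the energy bounds the drop across an edge, and drops add up along a path from
    [x] to [y]. *)
Lemma potential_drop_bound x y :
  exists2 C : R, 0 <= C & forall U, `|potential_drop U x y| <= C * `|U|.
Proof.
have [p + <-] := cond_connected N x y; elim: p x => /= [x _|z p IH x /andP[xz]].
  by exists 0 => // U; rewrite /potential_drop subrr normr0 mul0r.
move=> /IH[C C0 CP]; exists (Num.sqrt (2 / N x z) + C).
  by rewrite addr_ge0// sqrtr_ge0.
move=> U; rewrite mulrDl.
have -> : potential_drop U x (last z p) =
    potential_drop U x z + potential_drop U z (last z p).
  by rewrite /potential_drop addrA subrK.
rewrite (le_trans (ler_normD _ _))// lerD//.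
rewrite -(@ler_pXn2r _ 2)// ?nnegrE ?mulr_ge0 ?sqrtr_ge0// exprMn.
rewrite sqr_sqrtr ?divr_ge0 ?(ltW xz)// real_normK ?num_real//.
rewrite mulrAC ler_pdivlMr// mulrC.
have := @energy_term_le U [:: (x, z)] erefl.
by rewrite big_seq1.
Qed.

(** Drops converge by [potential_drop_bound], which defines a pointwise limit [u]. A Fatou argument
    on finite partial sums of the energy upgrades this to convergence in norm. *)
Lemma HE_complete (F : set_system (HE N)) : ProperFilter F -> cauchy F -> cvg F.
Proof.
move=> FF /cauchy_ballP cF.
have [[b]|G0] := pselect (inhabited G); last first.
  have U0 U : U = 0.
    rewrite -[U]repK -(class_of0 N); apply/class_ofP; exists 0.
    by apply/funext => x; case: G0.
  apply/cvg_ex; exists 0 => A /nbhs_singleton A0.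
  by apply: filterS filterT => U _; rewrite (U0 U).
have /choice[u uP] x : exists l : R, potential_drop U x b @[U --> F] --> l.
  have [C C0 CP] := potential_drop_bound x b.
  suff /cvg_ex[l] : cvg (potential_drop U x b @[U --> F]) by exists l.
  apply: cauchy_cvg; apply/cauchy_ballP => e e0.
  have C1 : 0 < C + 1 by rewrite ltr_wpDl.
  have eC : 0 < e / (C + 1) by rewrite divr_gt0.
  have [[A B] /= [FA FB] AB] := cF _ eC.
  exists ((fun U => potential_drop U x b) @` A,
          (fun U => potential_drop U x b) @` B).
    by split; [apply: filterS FA|apply: filterS FB] => U AU; exists U.
  move=> [_ _] [/= [U AU <-] [W BW <-]].
  have := AB (U, W) (conj AU BW); rewrite -!ball_normE /= => UW.
  rewrite -potential_dropB (le_lt_trans (CP _))//.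
  rewrite (@le_lt_trans _ _ ((C + 1) * `|U - W|))//.
    by rewrite ler_wpM2r// lerDl.
  by rewrite mulrC -ltr_pdivlMr.
have drop_cvg x y : potential_drop U x y @[U --> F] --> u x - u y.
  rewrite (_ : (fun U => potential_drop U x y) =
    (fun U => potential_drop U x b - potential_drop U y b)).
    exact: (cvgB (uP x) (uP y)).
  by apply/funext => U; rewrite /potential_drop opprB addrA subrK.
pose d U : G -> R := (rep U : G -> R) - u.
have near_u e : 0 < e -> \forall U \near F,
    finite_energy N (d U) /\ energy N (d U) (d U) <= e ^+ 2.
  move=> e0; have [[A B] /= [FA FB] AB] := cF _ e0.
  apply: filterS FA => U AU.
  pose g W (xy : G * G) := N xy.1 xy.2 * potential_drop (U - W) xy.1 xy.2 ^+ 2.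
  have term_cvg r : \sum_(xy <- r) g W xy @[W --> F] -->
      \sum_(xy <- r) energy_term N (d U) (d U) xy.
    elim: r => [|xy r IH].
      under eq_fun do rewrite big_nil.
      by rewrite big_nil; exact: cvg_cst.
    under eq_fun do rewrite big_cons.
    rewrite big_cons; apply: cvgD => //.
    rewrite /energy_term -mulrA -expr2; apply: cvgM; first exact: cvg_cst.
    have : potential_drop (U - W) xy.1 xy.2 @[W --> F] -->
        (d U) xy.1 - (d U) xy.2.
      rewrite (_ : _ - _ = potential_drop U xy.1 xy.2 - (u xy.1 - u xy.2)).
        under eq_fun do rewrite potential_dropB.
        by apply: cvgB; [exact: cvg_cst|exact: drop_cvg].
      by rewrite /potential_drop /d !fctE; ring.
    by move=> h; rewrite !expr2; exact: (cvgM h h).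
  have sum_le r : uniq r ->
      \sum_(xy <- r) energy_term N (d U) (d U) xy <= 2 * e ^+ 2.
    move=> ur; rewrite -(cvg_lim (@Rhausdorff R) (term_cvg r)).
    apply: limr_le; first by apply/cvg_ex; eexists; exact: term_cvg.
    apply: filterS FB => W BW; have := AB (U, W) (conj AU BW).
    rewrite -ball_normE /= => UW; apply: le_trans (energy_term_le _ ur) _.
    by rewrite ler_wpM2l// ler_pXn2r ?nnegrE ?(ltW e0)// ltW.
  have esum_le := esum_le_fin sum_le.
  split; first by apply: le_lt_trans esum_le _; rewrite ltry.
  rewrite /energy rsum_ge0E; last exact: energy_term_ge0.
  rewrite mulrC ler_pdivrMr// mulrC -lee_fin fineK//.
  rewrite ge0_fin_numE; first by apply: le_lt_trans esum_le _; rewrite ltry.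
  by apply: esum_ge0 => i _; rewrite lee_fin energy_term_ge0.
(* [u] is the difference of [rep U] and [d U] for a single [U] near the limit, both of finite
   energy. *)
have fu : finite_energy N u.
  have [U [+ _]] := filter_ex (near_u 1 ltr01).
  move=> /(finite_energyZ (-1))/(finite_energyD (finE_finite_energy (rep U))).
  by congr finite_energy; apply/funext => x; rewrite /d !fctE /GRing.scale /=; ring.
apply/cvg_ex; exists (class_of (FinE (asboolT fu))); apply/cvgrPdist_le => e e0.
apply: filterS (near_u e e0) => U [_ Ue].
rewrite distrC; apply: norm_le_sqr; first exact: ltW.
by rewrite -[U]repK -class_ofB dot_class.
Qed.

HB.instance Definition _ := Uniform_isComplete.Build (HE N) HE_complete.

Lemma dot_kernel_delta (o : G) (v : G -> HE N) x y : is_energy_kernel o v ->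
  y != o -> dot (v x) (delta N y) = (x == y)%:R.
Proof.
move=> vk yo; rewrite vk /delta potential_drop_class /= /indic1.
by rewrite (eq_sym o) (negbTE yo) subr0.
Qed.

(** * Gram-Schmidt for the energy kernel *)

Section GramSchmidt.
Variables (o : G) (v : G -> HE N) (x : nat -> G) (e : nat -> HE N).
Hypothesis v_kernel : is_energy_kernel o v.
Hypothesis x_bij : set_bij [set: nat] (~` [set o]) x.
Hypothesis e_gs : gram_schmidt (v \o x) e.

Let w n := v (x n) - \sum_(i < n) dot (v (x n)) (e i) *: e i.

Let eE n : e n = `|w n|^-1 *: w n. Proof. exact: e_gs. Qed.

Let x_neq n : x n != o.
Proof. by case: x_bij => xo _ _; apply/eqP; exact: xo. Qed.

Let x_eq m n : (x m == x n) = (m == n).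
Proof.
case: x_bij => _ xI _; apply/eqP/eqP => [|-> //].
by apply: xI; rewrite inE.
Qed.

(** [e i] is a combination of the kernels at [x 0, ..., x i], all orthogonal to the later
    [delta N (x n)]. *)
Lemma gram_schmidt_delta i n : (i < n)%N -> dot (e i) (delta N (x n)) = 0.
Proof.
elim/ltn_ind: i => i IH i_n; rewrite eE dotZl.
suff -> : dot (w i) (delta N (x n)) = 0 by rewrite mulr0.
rewrite /w dotBl (dot_kernel_delta _ v_kernel)// x_eq ltn_eqF// dot_suml.
rewrite big1 ?subrr// => j _.
by rewrite dotZl IH ?mulr0// (ltn_trans _ i_n).
Qed.

(** Linear independence of the kernels: only the first term of [w n] pairs nontrivially with
    [delta N (x n)], so the pairing is [1]. *)
Lemma gram_schmidt_neq0 n : w n != 0.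
Proof.
apply/eqP => w0; have := dot0l (delta N (x n)); rewrite -w0 /w dotBl.
rewrite (dot_kernel_delta _ v_kernel)// eqxx dot_suml big1 => [|i _].
  by rewrite subr0 => /eqP; rewrite oner_eq0.
by rewrite dotZl gram_schmidt_delta ?mulr0.
Qed.

Lemma gram_schmidt_orthonormal i j : dot (e i) (e j) = (i == j)%:R.
Proof.
(* Bounding both indices by [n] lets one induction treat both orders of [i] and [j]. *)
suff H n : forall i j, (i < n)%N -> (j < n)%N -> dot (e i) (e j) = (i == j)%:R.
  by apply: (H (maxn i j).+1); rewrite ltnS ?leq_maxl ?leq_maxr.
elim: n => // n IH {}i {}j.
have nn : dot (e n) (e n) = 1.
  rewrite dotvv eE normrZ normfV normr_id mulVf ?expr1n// normr_eq0.
  exact: gram_schmidt_neq0.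
have ni k : (k < n)%N -> dot (e n) (e k) = 0.
  move=> kn; rewrite eE dotZl; suff -> : dot (w n) (e k) = 0 by rewrite mulr0.
  rewrite /w dotBl dot_suml (bigD1 (Ordinal kn))//=.
  rewrite dotZl IH// eqxx mulr1 big1 ?addr0 ?subrr// => m.
  by rewrite -val_eqE /= => /negbTE mk; rewrite dotZl IH// mk mulr0.
rewrite ltnS [(i <= n)%N]leq_eqVlt => /predU1P[->|i_n];
  rewrite ltnS [(j <= n)%N]leq_eqVlt => /predU1P[->|j_n].
- by rewrite eqxx.
- by rewrite ni// gtn_eqF.
- by rewrite dotC ni// ltn_eqF.
- exact: IH.
Qed.

(** Each kernel is a combination of the [e i], so the reproducing property makes all drops of [h] to
    [o] vanish. *)
Lemma gram_schmidt_total h : (forall i, dot h (e i) = 0) -> h = 0.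
Proof.
move=> he; apply: (@HE_eq0 _ o) => y.
have [->|yo] := eqVneq y o; first by rewrite /potential_drop subrr.
have [n _ <-] : (x @` [set: nat]) y.
  by case: x_bij => _ _ xS; apply: xS; exact/eqP.
rewrite -v_kernel -[v _](subrK (\sum_(i < n) dot (v (x n)) (e i) *: e i)) -/(w n).
rewrite dotDl dot_suml big1 => [|i _]; last by rewrite dotZl (dotC (e i)) he mulr0.
have -> : w n = `|w n| *: e n.
  by rewrite eE scalerA divff ?scale1r// normr_eq0 gram_schmidt_neq0.
by rewrite dotZl (dotC (e n)) he mulr0 addr0.
Qed.

End GramSchmidt.

End EnergySpaceTheory.

Theorem theorem4p3 (R : realType) (G : choiceType) (N : network R G) (o : G)
    (L : operator (HE N)) :
  infinite_set [set: G] ->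
  constructionA o L \/ constructionB o L ->
  [/\ gelfand_triple (smooth L) (smooth_incl L),
      (forall (u : smooth L) (v : HE N),
         pairing u (riesz (smooth L) (smooth_incl L) v) = dot (smooth_incl L u) v) &
      forall (v : {linear smooth L -> R^o}), topological_dual v ->
      forall (p : nat) (K : R), 0 < K ->
      (forall u : smooth L, `|v u| <= K * `|op_power p u|) ->
      exists w : HE N, [/\ is_neg_power p v w,
        (forall w', is_neg_power p v w' -> w' = w) &
        forall u : smooth L, pairing u v = dot (op_power p u) w]].
Proof.
move=> _ constr.
have [L_sa L_unbounded] : self_adjoint L /\ ~ bounded_graph (op_graph L).
  case: constr => [[v [x [e [vk x_bij e_gs L_graph]]]]|[v [f [_ _ unb L_sa LM]]]].
    have e_on := gram_schmidt_orthonormal vk x_bij e_gs.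
    have e_tot := gram_schmidt_total vk x_bij e_gs.
    have := diagonal_op_self_adjoint e_on e_tot L_graph.
    by have := diagonal_op_unbounded e_on e_tot L_graph.
  (* In (B), a bound for [L] would also bound its restriction [laplacian_M v f]. *)
  split=> // -[C CP]; apply: unb; exists C => x y xy.
  by apply: CP; exact: LM.
split=> //; first exact: smooth_gelfand_triple.
move=> v _ p K K0 vK.
have [w vw] := neg_power_ex (ltW K0) vK.
exists w; split=> //; first by move=> w' vw'; exact: neg_power_unique vw' vw.
exact: neg_powerE vw.
Qed.
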